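(* Let $x\in\mathrm{Aper}(\sigma)$ and let $p\in[1,\infty]$. Then the unital contractive representation $\pi_x^p:\ell^1(\Sigma)\to\mathcal{B}(\ell^p(\mathbb{Z}))$ is: (1) algebraically irreducible if $p=1$; (2) not algebraically irreducible, but still topologically irreducible, if $p\in(1,\infty)$; (3) not topologically irreducible if $p=\infty$. If $p\in[1,\infty)$, then the commutant of $\pi_x^p(\ell^1(\Sigma))$ in $\mathcal{B}(\ell^p(\mathbb{Z}))$ equals the multiples of the identity operator.
   Context: $X$ is a non-empty compact Hausdorff space, $\sigma:X\to X$ is a homeomorphism, $\Sigma=(X,\sigma)$, and $\mathbb{Z}$ acts on $X$ via $n\mapsto\sigma^n$. $\mathrm{Aper}(\sigma)$ is the set of aperiodic points (points with infinite orbit). $C(X)$ is the algebra of continuous complex-valued functions with the supremum norm, and $\alpha(f)=f\circ\sigma^{-1}$ for $f\in C(X)$. $\ell^1(\Sigma)$ is the Banach space of all $a:\mathbb{Z}\to C(X)$ with $\|a\|=\sum_n\|a(n)\|<\infty$, with multiplication $(aa')(n)=\sum_{k\in\mathbb{Z}}a(k)\,\alpha^k(a'(n-k))$; it is a unital Banach algebra. Elements are written $a=\sum_n f_n\delta^n$ with $f_n=a(n)\in C(X)$, where $\delta$ is the element with $\delta(1)=1$ and $\delta(m)=0$ for $m\neq1$. For $x\in\mathrm{Aper}(\sigma)$ and $p\in[1,\infty]$, $\pi_x^p$ is the unital contractive representation of $\ell^1(\Sigma)$ on $\ell^p(\mathbb{Z})$ (two-sided complex sequences) in which $f\in C(X)$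 acts as multiplication of the $k$th coordinate by $f(\sigma^kx)$ for all $k\in\mathbb{Z}$, and $\delta$ acts as the right shift $S$, $(S\xi)(k)=\xi(k-1)$; i.e. $\pi_x^p(\sum_nf_n\delta^n)=\sum_n\pi_x^p(f_n)S^n$. $\mathcal{B}(E)$ denotes the bounded operators on a normed space $E$. A representation $\pi$ of an algebra $A$ on a vector space $E$ is algebraically irreducible if $\pi(A)E\neq\{0\}$ and the only invariant subspaces are $\{0\}$ and $E$; a representation by bounded operators on a normed space $E$ is topologically irreducible if $\pi(A)E\neq\{0\}$ and the only closed invariant subspaces are $\{0\}$ and $E$. *)

(* Defs.v *)
From HB Require Import structures.
From mathcomp Require Import all_boot all_order all_algebra.
From mathcomp Require Import finmap.
From mathcomp Require Import all_classical all_reals all_analysis.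
From mathcomp Require Import complex.
From mathcomp.analysis Require Import ess_sup_inf.
From mathcomp.analysis Require showcase.summability.

Set Implicit Arguments.
Unset Strict Implicit.
Unset Printing Implicit Defensive.

Import Order.TTheory GRing.Theory Num.Theory.
Import numFieldNormedType.Exports.

Local Open Scope classical_set_scope.
Local Open Scope ring_scope.
Local Open Scope complex_scope.

(* The norm of a normed module over R[i] takes its values in R[i]; [nrm] is the
   same norm with values in R (see [nrmE]). *)
Definition nrm (R : realType) (V : normedModType R[i]) (v : V) : R :=
  complex.Re `|v|.

Section nrm_theory.
Variables (R : realType) (V : normedModType R[i]).
Implicit Types (v w : V) (c : R[i]).

Lemma nrmE v : `|v| = (nrm v)%:C.
Proof. by rewrite /nrm RRe_real// realE normr_ge0. Qed.

Lemma nrm_ge0 v : 0 <= nrm v.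
Proof. by rewrite -lecR -nrmE normr_ge0. Qed.

Lemma nrmD v w : nrm (v + w) <= nrm v + nrm w.
Proof. by rewrite -lecR rmorphD/= -!nrmE ler_normD. Qed.

Lemma nrmZ c v : nrm (c *: v) = nrm (c : R[i]^o) * nrm v.
Proof.
apply: (@complexI R); rewrite rmorphM/= -nrmE normrZ nrmE; congr (_ * _).
Qed.

Lemma nrm_eq0 v : (nrm v == 0) = (v == 0).
Proof. by rewrite -(normr_eq0 v) nrmE (inj_eq (@complexI R)). Qed.

Lemma nrm0 : nrm (0 : V) = 0.
Proof. by apply/eqP; rewrite nrm_eq0. Qed.

Lemma nrm_ge0C (r : R) : 0 <= r -> nrm (r%:C : R[i]^o) = r.
Proof.
move=> r0; rewrite /nrm (_ : `|_| = r%:C)//.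
by apply: (@ger0_norm R[i]); rewrite lecR.
Qed.

End nrm_theory.

(* The discrete sigma-algebra on the integers, so that the l^p norms are Lnorms
   for the counting measure. *)
HB.instance Definition _ := isPointed.Build int 0.
HB.instance Definition _ := @isMeasurable.Build default_measure_display
  int discrete_measurable discrete_measurable0
  discrete_measurableC discrete_measurableU.

Section counting_int.
Variable R : realType.
Local Open Scope ereal_scope.

Lemma ae_countingP (P : int -> Prop) :
  {ae (@counting int R), forall k, P k} <-> forall k, P k.
Proof.
split=> [[A [mA A0 PA]] k|Pk]; last exact: aeW.
apply: contrapT => nPk; have Ak : A k by exact: PA.
move: A0; rewrite /= /counting; case: asboolP => // finA [] /eqP.
rewrite pnatr_eq0 cardfs_eq0 => /eqP /fset_set_set0 A0.
by rewrite A0// in Ak.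
Qed.

Lemma counting_int_gt0 : 0 < @counting int R [set: int].
Proof.
rewrite /counting; case: asboolP => // fT; rewrite lte_fin ltr0n cardfs_gt0.
by apply/fset0Pn; exists 0%R; rewrite in_fset_set// inE.
Qed.

Let nat_int (n : nat) : int := if odd n then Negz n./2 else Posz n./2.
Let int_nat (k : int) : nat :=
  match k with Posz n => n.*2 | Negz n => n.*2.+1 end.

Lemma ge0_integral_count_int (a : int -> \bar R) : (forall k, 0 <= a k) ->
  \int[@counting int R]_k a k = \esum_(k in [set: int]) a k.
Proof.
have nat_intB : set_bij [set: nat] [set: int] nat_int.
  have int_natK : cancel int_nat nat_int.
    move=> [n|n]; rewrite /nat_int/=; first by rewrite odd_double doubleK.
    by rewrite odd_double/= uphalf_double.
  have nat_intK : cancel nat_int int_nat.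
    move=> n; rewrite /nat_int; case: ifP => on /=;
    by rewrite -[RHS](odd_double_half n) on.
  split=> //; first by move=> m n _ _; exact: (can_inj nat_intK).
  by move=> k _; exists (int_nat k).
move=> a0; rewrite (reindex_esum setT setT nat_int)//.
transitivity (\int[mseries (fun n => \d_ (nat_int n)) 0%N]_k a k).
  congr (integral _ _ _); apply/funext => A.
  transitivity (\esum_(i in A) \d_ i A : \bar R).
    rewrite /= /counting; case: ifPn => /asboolP finA.
      by rewrite -finite_card_dirac.
    by rewrite infinite_card_dirac.
  rewrite /= /mseries nneseries_esumT//.
  rewrite -(reindex_esum setT setT nat_int (fun i => \d_ i A))//.
  rewrite [in RHS](esumID A)// !setTI [X in _ + X](_ : _ = 0) ?adde0//.
  by apply: esum1 => i Ai; rewrite /= /dirac indicE memNset.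
rewrite (@ge0_integral_measure_series _ _ R (fun n => \d_ (nat_int n)) setT)//=.
rewrite -nneseries_esumT//.
by apply: eq_eseriesr=> i _; rewrite integral_dirac//= diracT mul1e.
Qed.

End counting_int.

Section lpnorm.
Variables (R : realType) (V : normedModType R[i]).
Implicit Types (p : \bar R) (xi eta : int -> V).
Local Open Scope ereal_scope.

Definition lpnorm p xi : \bar R := 'N[counting]_p[(fun k => (nrm (xi k))%:E)].

Lemma lpnorm_ge0 p xi : 0 <= lpnorm p xi.
Proof. exact: Lnorm_ge0. Qed.

Lemma lpnorm_finE (r : R) xi : (0 < r)%R ->
  lpnorm r%:E xi = (\esum_(k in [set: int]) ((nrm (xi k)) `^ r)%:E) `^ r^-1.
Proof.
move=> r0; rewrite /lpnorm unlock ge0_integral_count_int//; last first.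
  by move=> k; rewrite poweR_ge0.
by congr (_ `^ _); apply: eq_esum => k _; rewrite /= ger0_norm// nrm_ge0.
Qed.

Lemma lpnorm1E xi : lpnorm 1 xi = \esum_(k in [set: int]) (nrm (xi k))%:E.
Proof.
rewrite lpnorm_finE// invr1 poweRe1; last first.
  by apply: esum_ge0 => k _; rewrite lee_fin powR_ge0.
by apply: eq_esum => k _; rewrite powRr1// nrm_ge0.
Qed.

Lemma lpnorm_inftyP xi y :
  lpnorm +oo xi <= y <-> forall k, (nrm (xi k))%:E <= y.
Proof.
rewrite /lpnorm unlock counting_int_gt0.
split=> [/ess_supP/ae_countingP h k|h].
  by apply: le_trans (h k); rewrite /= ger0_norm// nrm_ge0.
by apply/ess_supP/ae_countingP => k; rewrite /= ger0_norm ?nrm_ge0.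
Qed.

Lemma lpnorm_infty_ge xi k : (nrm (xi k))%:E <= lpnorm +oo xi.
Proof. by move: k; apply/lpnorm_inftyP. Qed.

End lpnorm.

Section lpnorm_theory.
Variables (R : realType) (V : normedModType R[i]).
Implicit Types (p : \bar R) (xi eta : int -> V).
Local Open Scope ereal_scope.

Lemma le_lpnorm (W : normedModType R[i]) p xi (eta : int -> W) : 1 <= p ->
  (forall k, (nrm (xi k) <= nrm (eta k))%R) -> lpnorm p xi <= lpnorm p eta.
Proof.
case: p => [r| |] // r1 h; last first.
  apply/lpnorm_inftyP => k; apply: le_trans (lpnorm_infty_ge eta k).
  by rewrite lee_fin.
have r0 : (0 < r)%R by rewrite (lt_le_trans ltr01).
rewrite !lpnorm_finE//; apply: gt0_ler_poweR.
- by rewrite invr_ge0 ltW.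
- by rewrite in_itv/= leey andbT esum_ge0// => k _; rewrite lee_fin powR_ge0.
- by rewrite in_itv/= leey andbT esum_ge0// => k _; rewrite lee_fin powR_ge0.
apply: le_esum => k _; rewrite lee_fin.
by apply: ge0_ler_powR; rewrite ?nnegrE ?nrm_ge0 ?(ltW r0).
Qed.

Lemma eq_lpnorm (W : normedModType R[i]) p xi (eta : int -> W) :
  (forall k, nrm (xi k) = nrm (eta k)) -> lpnorm p xi = lpnorm p eta.
Proof.
by move=> h; rewrite /lpnorm; congr Lnorm; apply/funext => k; rewrite h.
Qed.

Lemma lpnormD p xi eta : 1 <= p ->
  lpnorm p (xi + eta)%R <= lpnorm p xi + lpnorm p eta.
Proof.
move=> p1; pose N (zeta : int -> V) k := nrm (zeta k).
pose s k := ((N xi k + N eta k)%:C : R[i]^o).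
have sE k : nrm (s k) = (N xi k + N eta k)%R.
  by rewrite nrm_ge0C// addr_ge0 ?nrm_ge0.
apply: (@le_trans _ _ (lpnorm p s)).
  by apply: le_lpnorm => // k; rewrite sE nrmD.
rewrite (_ : lpnorm p s = 'N[counting]_p[EFin \o (N xi \+ N eta)%R]).
  exact: eminkowski.
by rewrite /lpnorm; congr Lnorm; apply/funext => k; rewrite sE.
Qed.

Lemma lpnormZ p (c : R[i]) xi : 1 <= p ->
  lpnorm p (c *: xi)%R = (nrm (c : R[i]^o))%:E * lpnorm p xi.
Proof.
set a := nrm _; have a0 : (0 <= a)%R by exact: nrm_ge0.
case: p => [r| |] // r1; rewrite /lpnorm unlock; last first.
  rewrite counting_int_gt0 -ess_supZl ?counting_int_gt0//.
  congr (ess_sup _ _); apply/funext => k /=.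
  by rewrite nrmZ normrM EFinM (ger0_norm a0).
have r0 : (0 < r)%R by rewrite (lt_le_trans ltr01).
rewrite (_ : (fun k => _ `^ r) =
    (fun k => (a `^ r)%:E * (`|(nrm (xi k))%:E| `^ r))); last first.
  apply/funext => k /=; rewrite nrmZ normrM (ger0_norm a0) -poweR_EFin EFinM.
  by rewrite poweRM ?lee_fin// poweR_EFin.
rewrite ge0_integralZl_EFin//; last 2 first.
- by move=> k _; rewrite poweR_ge0.
- by rewrite powR_ge0.
rewrite poweRM ?lee_fin ?powR_ge0//; last first.
  by apply: integral_ge0 => k _; rewrite poweR_ge0.
by rewrite poweR_EFin -powRrM mulfV ?gt_eqF// powRr1.
Qed.

Lemma lpnorm0 p : 1 <= p -> lpnorm p (0%R : int -> V) = 0.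
Proof.
move=> p1; rewrite -(Lnorm0 (@counting int R) (p := p)).
  by rewrite /lpnorm; congr Lnorm; apply/funext => k; rewrite nrm0.
by rewrite gt_eqF// (lt_le_trans _ p1).
Qed.

Lemma lpnorm_eq0 p xi : 1 <= p -> lpnorm p xi = 0 -> xi = 0%R.
Proof.
move=> p1 xi0.
have /ae_countingP h : (fun k => (nrm (xi k))%:E) = \0 %[ae @counting int R].
  by apply: (Lnorm_eq0_eq0 _ (lt_le_trans lte01 p1) xi0).
by apply/funext => k; apply/eqP; rewrite -nrm_eq0; apply/eqP; have [] := h k I.
Qed.

Lemma lpnorm_comp p xi (e : int -> int) : 1 <= p -> set_bij setT setT e ->
  lpnorm p (xi \o e) = lpnorm p xi.
Proof.
case: p => [r| |] // r1 eB; last first.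
  apply/eqP; rewrite eq_le; apply/andP; split; apply/lpnorm_inftyP => k.
    exact: lpnorm_infty_ge.
  have [_ _ /(_ k I)[j _ <-]] := eB.
  exact: (lpnorm_infty_ge (xi \o e) j).
have r0 : (0 < r)%R by rewrite (lt_le_trans ltr01).
rewrite !lpnorm_finE//; congr (_ `^ _).
exact/esym/(reindex_esum setT setT e (fun k => ((nrm (xi k)) `^ r)%:E)).
Qed.

End lpnorm_theory.

Section lp.
Variables (R : realType) (V : normedModType R[i]) (p : \bar R).
Variable p1 : (1 <= p)%E.

(* The hypothesis [1 <= p] is a parameter of the predicate and of the type
   because the vector space and norm axioms rely on it. *)
Definition lp_pred of (1 <= p)%E : {pred int -> V} :=
  fun xi => (lpnorm p xi < +oo)%E.

(* Two-sided V-valued sequences with finite p-norm: l^p(Z) for V = R[i]^o, and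
   the underlying space of l^1(Sigma) for V = C(X), p = 1. *)
Record lp := Lp {
  lp_fun :> int -> V;
  lp_finite : lp_pred p1 lp_fun }.

HB.instance Definition _ := [isSub of lp for lp_fun].
HB.instance Definition _ := [Choice of lp by <:].

Lemma lp_submod_closed : submod_closed (lp_pred p1).
Proof.
split=> [|a xi eta]; rewrite !unfold_in /lp_pred; first by rewrite lpnorm0.
move=> xioo etaoo; apply: le_lt_trans (lpnormD _ _ p1) _.
rewrite lte_add_pinfty// lpnormZ// lte_mul_pinfty// ?lee_fin//.
exact: nrm_ge0.
Qed.

HB.instance Definition _ := GRing.isSubmodClosed.Build _ _ (lp_pred p1)
  lp_submod_closed.
HB.instance Definition _ := [SubChoice_isSubLmodule of lp by <:].

Definition lp_norm (xi : lp) : R[i] := (fine (lpnorm p xi))%:C.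

Let lp_fineK (xi : lp) : (fine (lpnorm p xi))%:E = lpnorm p xi.
Proof. by rewrite fineK// ge0_fin_numE ?lpnorm_ge0//; exact: lp_finite. Qed.

Let lp_normD (xi eta : lp) : lp_norm (xi + eta) <= lp_norm xi + lp_norm eta.
Proof.
rewrite -rmorphD lecR -lee_fin EFinD !lp_fineK.
exact: lpnormD.
Qed.

Let lp_normZ (c : R[i]) (xi : lp) : lp_norm (c *: xi) = `|c| * lp_norm xi.
Proof.
rewrite /lp_norm (_ : lp_fun (c *: xi) = c *: (xi : int -> V))//.
rewrite lpnormZ// -lp_fineK -EFinM/= rmorphM/=; congr (_ * _).
Qed.

Let lp_norm_eq0 (xi : lp) : lp_norm xi = 0 -> xi = 0.
Proof.
move=> /(@complexI R) h; apply/val_inj/(lpnorm_eq0 p1).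
by rewrite -lp_fineK h.
Qed.

HB.instance Definition _ :=
  Lmodule_isNormed.Build R[i] lp lp_normD lp_normZ lp_norm_eq0.

Lemma lp_nrmE (xi : lp) : (nrm xi)%:E = lpnorm p xi.
Proof. by rewrite -lp_fineK. Qed.

End lp.

Section bounded_operators.
Variables (R : realType) (E : normedModType R[i]).

(* Linear and bounded maps; [bop E] is the space B(E) with the operator norm. *)
Definition bop_pred : {pred E -> E} := fun T =>
  `[< (forall (c : R[i]) (u v : E), T (c *: u + v) = c *: T u + T v) /\
      exists M : R, forall v, nrm (T v) <= M * nrm v >].

Record bop := Bop {
  bop_fun :> E -> E;
  bopP : bop_pred bop_fun }.

HB.instance Definition _ := [isSub of bop for bop_fun].
HB.instance Definition _ := [Choice of bop by <:].

Lemma bop_submod_closed : submod_closed bop_pred.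
Proof.
split=> [|a S T]; rewrite !unfold_in.
  apply/asboolP; split=> [c u v|]; first by rewrite /= scaler0 addr0.
  by exists 0 => v; rewrite /= nrm0 mul0r.
move=> /asboolP[Slin [M SM]] /asboolP[Tlin [N TN]]; apply/asboolP.
have ST w : (a *: S + T) w = a *: S w + T w by [].
split=> [c u v|].
  rewrite !ST Slin Tlin !scalerDr !scalerA (mulrC a) -!addrA.
  by congr (_ + _); rewrite addrCA.
exists (nrm (a : R[i]^o) * M + N) => v; rewrite ST.
rewrite (le_trans (nrmD _ _))// mulrDl lerD// nrmZ -mulrA.
by rewrite ler_wpM2l ?nrm_ge0.
Qed.

HB.instance Definition _ := GRing.isSubmodClosed.Build _ _ bop_pred
  bop_submod_closed.
HB.instance Definition _ := [SubChoice_isSubLmodule of bop by <:].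

Lemma bop_linear (T : bop) c u v : T (c *: u + v) = c *: T u + T v.
Proof. by have /asboolP[+ _] := bopP T; exact. Qed.

Lemma bop0 (T : bop) : T 0 = 0.
Proof.
by have := bop_linear T (-1) 0 0; rewrite scaler0 addr0 scaleN1r addNr.
Qed.

Lemma bopZ (T : bop) c u : T (c *: u) = c *: T u.
Proof. by have := bop_linear T c u 0; rewrite bop0 !addr0. Qed.

Lemma bopD (T : bop) u v : T (u + v) = T u + T v.
Proof. by have := bop_linear T 1 u v; rewrite !scale1r. Qed.

Definition opnorm (T : bop) : R :=
  sup [set nrm (T v) | v in [set v | nrm v <= 1]].

Let opnorm_has_sup (T : bop) :
  has_sup [set nrm (T v) | v in [set v | nrm v <= 1]].
Proof.
split; first by exists (nrm (T 0)), 0 => //=; rewrite nrm0.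
have /asboolP[_ [M TM]] := bopP T; exists (Num.max M 0) => _ [v /= v1 <-].
apply: (le_trans (TM v)); apply: (@le_trans _ _ (Num.max M 0 * nrm v)).
  by rewrite ler_wpM2r ?nrm_ge0// le_max lexx.
by rewrite ler_piMr// le_max lexx orbT.
Qed.

Lemma opnorm_ge (T : bop) v : nrm (T v) <= opnorm T * nrm v.
Proof.
have [->|v0] := eqVneq v 0; first by rewrite bop0 !nrm0 mulr0.
have nv0 : 0 < nrm v by rewrite lt_neqAle eq_sym nrm_eq0 v0 nrm_ge0.
rewrite -ler_pdivrMr//.
have nV : nrm ((((nrm v)^-1)%:C : R[i]^o)) = (nrm v)^-1.
  by rewrite nrm_ge0C// invr_ge0 ltW.
apply: sup_upper_bound => //; exists (((nrm v)^-1)%:C *: v).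
  by rewrite /= nrmZ nV mulVf// gt_eqF.
by rewrite bopZ nrmZ nV mulrC.
Qed.

Lemma opnorm_le (T : bop) M :
  (forall v, nrm v <= 1 -> nrm (T v) <= M) -> opnorm T <= M.
Proof.
move=> TM; apply: ge_sup; last by move=> _ [v v1 <-]; exact: TM.
by have [] := opnorm_has_sup T.
Qed.

Lemma opnorm_ge0 (T : bop) : 0 <= opnorm T.
Proof.
apply: (le_trans (nrm_ge0 (T 0))); apply: sup_upper_bound => //.
by exists 0 => //=; rewrite nrm0.
Qed.

Let bop_norm (T : bop) : R[i] := (opnorm T)%:C.

Let bop_normD (S T : bop) : bop_norm (S + T) <= bop_norm S + bop_norm T.
Proof.
rewrite -rmorphD lecR; apply: opnorm_le => v v1.
apply: (le_trans (nrmD _ _)); rewrite lerD// (le_trans (opnorm_ge _ _))//.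
  by rewrite ler_piMr// opnorm_ge0.
by rewrite ler_piMr// opnorm_ge0.
Qed.

Let opnormZ_le (c : R[i]) (T : bop) :
  opnorm (c *: T) <= nrm (c : R[i]^o) * opnorm T.
Proof.
apply: opnorm_le => v v1; rewrite /= nrmZ ler_wpM2l ?nrm_ge0//.
by rewrite (le_trans (opnorm_ge _ _))// ler_piMr// opnorm_ge0.
Qed.

Let bop_normZ (c : R[i]) (T : bop) : bop_norm (c *: T) = `|c| * bop_norm T.
Proof.
rewrite (_ : `|c| = (nrm (c : R[i]^o))%:C); last exact: (nrmE (c : R[i]^o)).
rewrite -rmorphM/=; congr (_%:C).
apply/eqP; rewrite eq_le opnormZ_le/=.
have [->|c0] := eqVneq c 0.
  by rewrite (nrm0 R[i]^o) mul0r; exact: opnorm_ge0.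
have nc0 : 0 < nrm (c : R[i]^o) by rewrite lt_neqAle eq_sym nrm_eq0 c0 nrm_ge0.
rewrite -ler_pdivlMl//; rewrite -[in leLHS](scale1r T) -(mulVf c0) -scalerA.
apply: (le_trans (opnormZ_le _ _)).
rewrite (_ : nrm _ = (nrm (c : R[i]^o))^-1)//.
apply: (mulfI (lt0r_neq0 nc0)); rewrite mulfV ?gt_eqF//.
rewrite -(nrmZ c (c^-1 : R[i]^o)) /GRing.scale/= mulfV//.
by apply: (@complexI R); rewrite -nrmE normr1.
Qed.

Let bop_norm_eq0 (T : bop) : bop_norm T = 0 -> T = 0.
Proof.
move=> /(@complexI R) T0; apply/val_inj/funext => v; apply/eqP.
by rewrite -nrm_eq0 eq_le nrm_ge0 andbT (le_trans (opnorm_ge _ _))// T0 mul0r.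
Qed.

HB.instance Definition _ :=
  Lmodule_isNormed.Build R[i] bop bop_normD bop_normZ bop_norm_eq0.

Lemma bop_nrmE (T : bop) : nrm T = opnorm T.
Proof. by []. Qed.

Fact bop_id_subproof : bop_pred id.
Proof. by apply/asboolP; split=> //; exists 1 => v; rewrite mul1r. Qed.
Definition bop_id := Bop bop_id_subproof.

Fact bop_comp_subproof (S T : bop) : bop_pred (S \o T).
Proof.
apply/asboolP; split=> [c u v|]; first by rewrite /= !bop_linear.
exists (opnorm S * opnorm T) => v; rewrite -mulrA (le_trans (opnorm_ge _ _))//.
by rewrite ler_wpM2l ?opnorm_ge0 ?opnorm_ge.
Qed.
Definition bop_comp S T := Bop (bop_comp_subproof S T).

Definition commutant (A : set bop) : set bop :=
  [set T | forall S, A S -> bop_comp T S = bop_comp S T].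

End bounded_operators.

(* The k-th power of a bijection [f] with inverse [g]. *)
Definition int_iter (T : Type) (f g : T -> T) (k : int) : T -> T :=
  match k with Posz n => iter n f | Negz n => iter n.+1 g end.

Record dynSystem := DynSystem {
  space :> topologicalType;
  space_nonempty : [set: space] !=set0;
  space_compact : compact [set: space];
  space_hausdorff : hausdorff_space space;
  sigma : space -> space;
  sigmaV : space -> space;
  sigmaK : cancel sigma sigmaV;
  sigmaVK : cancel sigmaV sigma;
  sigma_continuous : continuous sigma;
  sigmaV_continuous : continuous sigmaV }.

Definition sigmaX (X : dynSystem) (k : int) : X -> X :=
  int_iter (@sigma X) (@sigmaV X) k.

Definition Aper {X : dynSystem} : set X :=
  [set x | infinite_set (range (fun k : int => sigmaX k x))].

Lemma nrm_continuous (R : realType) (V : normedModType R[i]) :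
  continuous (@nrm R V).
Proof.
move=> v; apply/cvgrPdist_lt => e e0.
have : \forall w \near v, `|v - w| < e%:C.
  by have := @cvgr_dist_lt _ _ _ (nbhs v) _ id v cvg_id; apply; rewrite ltcR.
apply: filterS => w; rewrite nrmE ltcR; apply: le_lt_trans.
rewrite ler_norml; apply/andP; split; last first.
  by rewrite lerBlDr (le_trans _ (nrmD _ _))// subrK.
rewrite lerNl opprB lerBlDr (_ : nrm (v - w) = nrm (w - v)).
  by rewrite (le_trans _ (nrmD _ _))// subrK.
by apply: (@complexI R); rewrite -!nrmE distrC.
Qed.

Section continuous_functions.
Variables (R : realType) (X : dynSystem).

(* C(X) with the supremum norm (see [CX_nrmE]); scalars are written R[i]^o where
   R[i] is seen as a normed module over itself. *)
Definition CX := continuousType X R[i]^o.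

Definition CX_pred : {pred X -> R[i]^o} := mem [set f | continuous f].

HB.instance Definition _ := Equality.on CX.
HB.instance Definition _ := Choice.on CX.

Section Sub.
Context (f : X -> R[i]^o) (fP : f \in CX_pred).
#[local] HB.instance Definition _ :=
  @isContinuous.Build X R[i]^o f (set_mem fP).
Definition CX_Sub : CX := [the continuousType _ _ of f].
End Sub.

Let CX_rect (K : CX -> Type) :
  (forall f (Pf : f \in CX_pred), K (CX_Sub Pf)) -> forall u, K u.
Proof.
move=> Ksub [f [[cf]]].
have Pf : f \in CX_pred by rewrite inE.
rewrite (Prop_irrelevance cf (set_mem Pf)); exact: Ksub.
Qed.

Let CX_valP f (Pf : f \in CX_pred) : CX_Sub Pf = f :> (_ -> _).
Proof. by []. Qed.

HB.instance Definition _ := isSub.Build _ _ CX CX_rect CX_valP.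

Lemma CX_submod_closed : submod_closed CX_pred.
Proof.
split; first by apply/mem_set => x; exact: cvg_cst.
move=> a f g /set_mem cf /set_mem cg; apply/mem_set => x.
apply: (@cvgD R[i] R[i]^o); last exact: cg.
apply: (@continuous_comp X R[i]^o R[i]^o f (fun z => a *: z)); first exact: cf.
exact: (@scaler_continuous R[i] R[i]^o a).
Qed.

HB.instance Definition _ := GRing.isSubmodClosed.Build _ _ CX_pred
  CX_submod_closed.
HB.instance Definition _ := [SubChoice_isSubLmodule of CX by <:].

Definition supnorm (f : CX) : R := sup [set nrm (f x) | x in [set: X]].

Let supnorm_has_sup (f : CX) : has_sup [set nrm (f x) | x in [set: X]].
Proof.
have [x _] := space_nonempty X; split; first by exists (nrm (f x)), x.
have cf : continuous (fun y => nrm (f y)).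
  move=> y; apply: (@continuous_comp X R[i]^o R f (@nrm R R[i]^o)).
    exact: (@cts_fun X R[i]^o f).
  exact: nrm_continuous.
have [c _ fc] := compact_EVT_max (space_nonempty X) (@space_compact X)
  (continuous_subspaceT cf).
by exists (nrm (f c)) => _ [y _ <-]; apply: fc; rewrite inE.
Qed.

Lemma supnorm_ge (f : CX) x : nrm (f x) <= supnorm f.
Proof. by apply: sup_upper_bound => //; exists x. Qed.

Lemma supnorm_le (f : CX) M : (forall x, nrm (f x) <= M) -> supnorm f <= M.
Proof.
move=> fM; apply: ge_sup; last by move=> _ [x _ <-].
by have [] := supnorm_has_sup f.
Qed.

Let CX_norm (f : CX) : R[i] := (supnorm f)%:C.

Let CX_normD (f g : CX) : CX_norm (f + g) <= CX_norm f + CX_norm g.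
Proof.
rewrite -rmorphD lecR; apply: supnorm_le => x.
by rewrite (le_trans (nrmD _ _))// lerD// supnorm_ge.
Qed.

Let CX_normZ (c : R[i]) (f : CX) : CX_norm (c *: f) = `|c| * CX_norm f.
Proof.
rewrite (_ : `|c| = (nrm (c : R[i]^o))%:C); last exact: (nrmE (c : R[i]^o)).
rewrite -rmorphM/=; congr (_%:C).
have [->|c0] := eqVneq c 0.
  rewrite (nrm0 R[i]^o) mul0r scale0r; apply/eqP; rewrite eq_le.
  rewrite supnorm_le/=; last by move=> x; rewrite nrm0.
  have [x _] := space_nonempty X.
  by rewrite (le_trans _ (supnorm_ge _ x))// nrm_ge0.
have nc0 : 0 < nrm (c : R[i]^o) by rewrite lt_neqAle eq_sym nrm_eq0 c0 nrm_ge0.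
apply/eqP; rewrite eq_le; apply/andP; split.
  by apply: supnorm_le => x; rewrite nrmZ ler_wpM2l ?nrm_ge0 ?supnorm_ge.
rewrite -ler_pdivlMl//; apply: supnorm_le => x.
rewrite ler_pdivlMl// -nrmZ; exact: (supnorm_ge (c *: f) x).
Qed.

Let CX_norm_eq0 (f : CX) : CX_norm f = 0 -> f = 0.
Proof.
move=> /(@complexI R) f0; apply/val_inj/funext => x; apply/eqP.
by rewrite -nrm_eq0 eq_le nrm_ge0 andbT -[leRHS]f0; exact: supnorm_ge.
Qed.

HB.instance Definition _ :=
  Lmodule_isNormed.Build R[i] CX CX_normD CX_normZ CX_norm_eq0.

Lemma CX_nrmE (f : CX) : nrm f = supnorm f.
Proof. by []. Qed.

Fact CX_mul_subproof (f g : CX) : (fun x => f x * g x) \in CX_pred.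
Proof.
rewrite inE => x; apply: (@cvgM R[i] _ _ _ f g).
  exact: (@cts_fun X R[i]^o f).
exact: (@cts_fun X R[i]^o g).
Qed.
Definition CX_mul (f g : CX) : CX := CX_Sub (CX_mul_subproof f g).

Fact CX_one_subproof : (fun=> 1) \in CX_pred.
Proof. by rewrite inE => x; exact: cvg_cst. Qed.
Definition CX_one : CX := CX_Sub CX_one_subproof.

Fact alpha_subproof (f : CX) : f \o @sigmaV X \in CX_pred.
Proof.
rewrite inE => x; apply: continuous_comp; first exact: sigmaV_continuous.
exact: (@cts_fun X R[i]^o f).
Qed.
Definition alpha (f : CX) : CX := CX_Sub (alpha_subproof f).

Fact alphaV_subproof (f : CX) : f \o @sigma X \in CX_pred.
Proof.
rewrite inE => x; apply: continuous_comp; first exact: sigma_continuous.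
exact: (@cts_fun X R[i]^o f).
Qed.
Definition alphaV (f : CX) : CX := CX_Sub (alphaV_subproof f).

Definition alphaX (k : int) : CX -> CX := int_iter alpha alphaV k.

Lemma CX_mulE f g x : CX_mul f g x = f x * g x. Proof. by []. Qed.

Lemma CX_nrmM f g : nrm (CX_mul f g) <= nrm f * nrm g.
Proof.
apply: supnorm_le => x; rewrite CX_mulE (nrmZ (f x) (g x : R[i]^o)).
by rewrite ler_pM ?nrm_ge0// supnorm_ge.
Qed.

Lemma nrm_alpha f : nrm (alpha f) <= nrm f.
Proof. by apply: supnorm_le => x; exact: (supnorm_ge f (sigmaV x)). Qed.

Lemma nrm_alphaV f : nrm (alphaV f) <= nrm f.
Proof. by apply: supnorm_le => x; exact: (supnorm_ge f (sigma x)). Qed.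

Lemma alphaXE k f x : alphaX k f x = f (sigmaX (- k) x).
Proof.
case: k => n.
  have -> : sigmaX (- Posz n) x = iter n (@sigmaV X) x by case: n.
  by rewrite /alphaX/=; elim: n x => //= n IHn x; rewrite IHn -iterSr.
have -> : sigmaX (- Negz n) x = iter n.+1 (@sigma X) x by [].
have -> : alphaX (Negz n) f = iter n.+1 alphaV f by [].
by elim: n.+1 x => // m IHm x; rewrite [in RHS]iterSr -IHm.
Qed.

Lemma nrm_alphaX k f : nrm (alphaX k f) <= nrm f.
Proof.
case: k => n; rewrite /alphaX/=.
  elim: n => //= n IHn; exact: le_trans (nrm_alpha _) IHn.
apply: le_trans (nrm_alphaV _) _.
by elim: n => //= n IHn; exact: le_trans (nrm_alphaV _) IHn.
Qed.

End continuous_functions.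

Section sums.
Variable R : realType.
Local Open Scope ereal_scope.

(* [summability.sum u] is the limit of the finite partial sums of [u] along the
   directed set of finite sets of indices, or [point] without convergence. *)
Lemma nrm_sum_le (V : normedModType R[i]) (u : int -> V) :
  point = 0%R :> V ->
  (nrm (summability.sum u))%:E <= \esum_(k in [set: int]) (nrm (u k))%:E.
Proof.
move=> p0; set M := esum _ _.
have M0 : 0 <= M by apply: esum_ge0 => k _; rewrite lee_fin nrm_ge0.
have [cu|ncu] :=
    pselect (cvg (summability.partial_sum u @ summability.totally));
  last by rewrite /summability.sum dvgP// p0 nrm0.
have [->|Moo] := eqVneq M +oo; first by rewrite leey.
have Mfin : M \is a fin_num by rewrite ge0_fin_numE// ltey.
rewrite -(fineK Mfin) lee_fin.
have FF : ProperFilter (@summability.totally int) := summability.totally_filter.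
apply: (@closed_cvg _ V (@summability.totally int) FF
    (summability.partial_sum u) (fun v => (nrm v <= fine M)%R)).
- refine (@preimage_closed V R (@nrm R V) [set r | r <= fine M]%R _ _).
    by move=> ? _; exact: nrm_continuous.
  exact: closed_le.
- apply: nearW => A; rewrite -lee_fin (fineK Mfin) /summability.partial_sum.
  apply: (@le_trans _ _ (\sum_(k <- A) (nrm (u k))%:E)).
    rewrite sumEFin lee_fin big_seq_fsetE/=.
    by elim/big_ind2: _ => [|x r y t xr yt|k _]; rewrite ?nrm0//
      (le_trans (nrmD _ _))// lerD.
  apply: ereal_sup_ubound; exists [set` A].
    by split=> //; exact: finite_fset.
  by rewrite fsbig_finite//= set_fsetK.
- exact: cu.
Qed.

Lemma esum_exchange (a : int -> int -> \bar R) : (forall i j, 0 <= a i j) ->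
  \esum_(i in [set: int]) \esum_(j in [set: int]) a i j =
  \esum_(j in [set: int]) \esum_(i in [set: int]) a i j.
Proof.
move=> a0.
rewrite !esum_esum//.
rewrite (reindex_esum ([set: int] `*`` fun=> [set: int])
  ([set: int] `*`` fun=> [set: int])
  (fun x => (x.2, x.1)) (fun x => a x.1 x.2))//.
split=> //; first by move=> [x1 x2] [y1 y2] _ _ [-> ->].
by move=> [x1 x2] _; exists (x2, x1).
Qed.

Lemma esumZl (r : R) (a : int -> \bar R) : (0 <= r)%R -> (forall i, 0 <= a i) ->
  \esum_(i in [set: int]) (r%:E * a i) = r%:E * \esum_(i in [set: int]) a i.
Proof.
move=> r0 a0; rewrite -!ge0_integral_count_int//; last first.
  by move=> k; rewrite mule_ge0.
by rewrite ge0_integralZl_EFin.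
Qed.

End sums.

Section ell1_algebra.
Variables (R : realType) (X : dynSystem).

Definition ell1 := @lp R (CX R X) 1%E (lexx 1%E).
HB.instance Definition _ := NormedModule.on ell1.

Fact ell1_mul_subproof (a b : ell1) : lp_pred (lexx 1%E)
  (fun n => summability.sum (fun k => CX_mul (a k) (alphaX k (b (n - k))))).
Proof.
rewrite /lp_pred lpnorm1E.
apply: (@le_lt_trans _ _ (\esum_(n in [set: int]) \esum_(k in [set: int])
    ((nrm (a k))%:E * (nrm (b (n - k)%R))%:E)))%E.
  apply: le_esum => n _; apply: le_trans (nrm_sum_le _ _) _ => //.
  apply: le_esum => k _; rewrite -EFinM lee_fin.
  by rewrite (le_trans (CX_nrmM _ _))// ler_wpM2l ?nrm_ge0// nrm_alphaX.
rewrite esum_exchange; last first.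
  by move=> i j; rewrite -EFinM lee_fin mulr_ge0 ?nrm_ge0.
apply: (@le_lt_trans _ _ (\esum_(k in [set: int])
    ((nrm b)%:E * (nrm (a k))%:E)))%E.
  apply: le_esum => k _; rewrite esumZl ?nrm_ge0//; last first.
    by move=> n; rewrite lee_fin nrm_ge0.
  rewrite muleC lee_wpmul2r ?lee_fin ?nrm_ge0//.
  rewrite lp_nrmE lpnorm1E.
  rewrite (reindex_esum setT setT (fun n => n - k) (fun n => (nrm (b n))%:E))//.
  split=> //; first by move=> m n _ _ /addIr.
  by move=> n _; exists (n + k) => //; rewrite addrK.
rewrite esumZl ?nrm_ge0//; last by move=> n; rewrite lee_fin nrm_ge0.
by rewrite lte_mul_pinfty ?lee_fin ?nrm_ge0// -lpnorm1E -lp_nrmE ltey.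
Qed.

Definition ell1_mul (a b : ell1) : ell1 := Lp (ell1_mul_subproof a b).

Fact ell1_one_subproof :
  lp_pred (lexx 1%E) (fun n : int => if n == 0 then CX_one R X else 0).
Proof.
rewrite /lp_pred lpnorm1E.
rewrite (_ : esum _ _ = esum [set (0 : int)] (fun=> (nrm (CX_one R X))%:E)).
  by rewrite esum_set1 ?lee_fin ?nrm_ge0// ltey.
rewrite [RHS]esum_mkcond; apply: eq_esum => n _.
case: eqVneq => [->|n0]; first by rewrite mem_set.
by rewrite memNset ?nrm0//; apply/eqP.
Qed.
Definition ell1_one : ell1 := Lp ell1_one_subproof.

End ell1_algebra.

Section representation.
Variables (R : realType) (X : dynSystem) (x : X) (p : \bar R).
Variable p1 : (1 <= p)%E.

Notation lpZ := (@lp R R[i]^o p p1).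

Fact mul_seq_subproof (f : CX R X) (xi : lpZ) :
  lp_pred p1 (fun k => f (sigmaX k x) * xi k : R[i]^o).
Proof.
rewrite /lp_pred.
apply: (@le_lt_trans _ _ (lpnorm p ((nrm f)%:C *: (xi : int -> R[i]^o)))).
  apply: le_lpnorm => // k; rewrite [leRHS]nrmZ.
  rewrite (nrmZ _ (xi k)) ler_wpM2r ?nrm_ge0//.
  by rewrite nrm_ge0C ?nrm_ge0//; exact: supnorm_ge.
by rewrite lpnormZ// lte_mul_pinfty// ?lee_fin ?nrm_ge0//; exact: lp_finite.
Qed.
Definition mul_seq f xi : lpZ := Lp (mul_seq_subproof f xi).

Fact mul_op_subproof f : bop_pred (mul_seq f).
Proof.
apply/asboolP; split=> [c xi eta|].
  by apply/val_inj/funext => k /=; rewrite mulrDr [LHS]/(_ + _) mulrCA.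
exists (nrm f) => xi; rewrite -lee_fin EFinM !lp_nrmE.
rewrite -[in leRHS](nrm_ge0C (nrm_ge0 f)).
rewrite -lpnormZ//; apply: le_lpnorm => // k; rewrite [leRHS]nrmZ.
rewrite (nrmZ _ (xi k)) ler_wpM2r ?nrm_ge0//.
by rewrite nrm_ge0C ?nrm_ge0//; exact: supnorm_ge.
Qed.
Definition mul_op (f : CX R X) : bop lpZ := Bop (mul_op_subproof f).

Lemma addint_bij (c : int) : set_bij setT setT (fun k : int => k + c).
Proof.
split=> //; first by move=> m n _ _ /addIr.
by move=> n _; exists (n - c) => //; rewrite subrK.
Qed.

Fact translate_subproof (c : int) (xi : lpZ) : lp_pred p1 (fun k => xi (k + c)).
Proof.
rewrite /lp_pred (lpnorm_comp xi p1 (addint_bij c)); exact: lp_finite.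
Qed.
Definition translate c xi : lpZ := Lp (translate_subproof c xi).

Fact translate_op_subproof c : bop_pred (translate c).
Proof.
apply/asboolP; split=> [a xi eta|]; first exact/val_inj/funext.
exists 1 => xi; rewrite mul1r -lee_fin !lp_nrmE.
by rewrite (lpnorm_comp xi p1 (addint_bij c)).
Qed.

Definition shift : bop lpZ := Bop (translate_op_subproof (-1)).
Definition shiftV : bop lpZ := Bop (translate_op_subproof 1).
Definition shiftX (n : int) : bop lpZ :=
  int_iter (bop_comp shift) (bop_comp shiftV) n (bop_id lpZ).

Lemma shiftXE n (xi : lpZ) k : shiftX n xi k = xi (k - n).
Proof.
case: n => n.
  rewrite /shiftX/=; elim: n k => [|n IHn] k /=; first by rewrite subr0.
  by rewrite [LHS]IHn intS opprD addrA.
rewrite -[shiftX _]/(iter n.+1 (bop_comp shiftV) (bop_id lpZ)).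
rewrite NegzE opprK; elim: n.+1 k => [|m IHm] k; first by rewrite addr0.
by rewrite [LHS](IHm (k + 1)) intS addrA.
Qed.

(* pi_x^p(sum_n f_n delta^n) = sum_n pi_x^p(f_n) S^n, the sum being taken in the
   operator norm of B(l^p(Z)). *)
Definition pi_rep (a : ell1 R X) : bop lpZ :=
  summability.sum (fun n => bop_comp (mul_op (a n)) (shiftX n)).

End representation.

Section irreducibility.
Variables (R : realType) (A : Type).

Definition subspace (E : lmodType R[i]) (M : set E) : Prop :=
  M 0 /\ forall (c : R[i]) u v, M u -> M v -> M (c *: u + v).

Definition invariant (E : Type) (rho : A -> E -> E) (M : set E) : Prop :=
  forall a v, M v -> M (rho a v).

Definition nondegenerate (E : lmodType R[i]) (rho : A -> E -> E) : Prop :=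
  [set rho a v | a in setT & v in setT] <> [set 0].

Definition alg_irreducible (E : lmodType R[i]) (rho : A -> E -> E) : Prop :=
  nondegenerate rho /\
  forall M, subspace M -> invariant rho M -> M = [set 0] \/ M = setT.

Definition top_irreducible (E : normedModType R[i]) (rho : A -> bop E) : Prop :=
  nondegenerate rho /\
  forall M, subspace M -> closed M -> invariant rho M ->
    M = [set 0] \/ M = setT.

End irreducibility.

Definition unital_contractive_rep (R : realType) (X : dynSystem)
    (E : normedModType R[i]) (rho : ell1 R X -> bop E) : Prop :=
  [/\ forall (c : R[i]) a b, rho (c *: a + b) = c *: rho a + rho b,
      forall a b, rho (ell1_mul a b) = bop_comp (rho a) (rho b),
      rho (ell1_one R X) = bop_id E &
      forall a, `|rho a| <= `|a| ].

(* Main.v *)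
(* For a family indexed by Z whose norms are summable, the finite partial sums
   converge in each of C, C(X), l^p and B(E); so the series defining pi_x^p and
   the product of l^1(Sigma) converge, and pi_x^p is multiplicative because
   iterated absolutely convergent sums can be exchanged.

   As x is aperiodic, Urysohn's lemma gives f in C(X) with |f| <= 1, f = 1 at
   sigma^k x and f = 0 at finitely many other points of the orbit.  For
   p < oo this brings f xi as close as wanted to xi(k) e_k, so that a closed
   invariant subspace containing xi <> 0 contains every e_k and is everything;
   the same functions show that an operator commuting with the representation
   maps e_k to a fixed multiple of e_k.  For p = 1, an element g of an invariant
   subspace with |g - e_0| <= 1/2 is already cyclic: zeta |-> pi(zeta) g differs
   from the identity by an operator of norm at most 1/2, hence is onto by the
   Neumann series.  For 1 < p < oo the subspace l^1 of l^p is invariant, and for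
   p = oo the closed subspace c_0 is. *)
Require Import Defs.
From mathcomp Require Import all_boot all_order all_algebra.
From mathcomp Require Import finmap.
From mathcomp Require Import all_classical all_reals all_analysis.
From mathcomp Require Import complex ring lra.
From mathcomp.analysis Require showcase.summability.

Set Implicit Arguments.
Unset Strict Implicit.
Unset Printing Implicit Defensive.

Import Order.TTheory GRing.Theory Num.Theory.
Import numFieldNormedType.Exports.

Local Open Scope classical_set_scope.
Local Open Scope ring_scope.
Local Open Scope complex_scope.

(** * Unconditional sums over Z *)

Section sum_to.
Variable R : realType.

(** The total is finite, so some finite set has a sum within e of it; additivity over the set and
    its complement leaves less than e for the tail. *)
Lemma esum_tail (a : int -> \bar R) (e : R) : (forall k, 0 <= a k)%E ->
  (\esum_(k in [set: int]) a k < +oo)%E -> 0 < e ->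
  exists A : {fset int}, (\esum_(k in ~` [set` A]) a k < e%:E)%E.
Proof.
move=> a0 aoo e0; set S := esum _ _ in aoo.
have Sfin : S \is a fin_num by rewrite ge0_fin_numE// esum_ge0.
have [_ [F [finF _] <-] SF] := ub_ereal_sup_adherent e0 Sfin.
exists (fset_set F); rewrite fset_setK//.
have SE : S = (esum F a + esum (~` F) a)%E by rewrite /S (esumID F)// !setTI.
have {}SF : (S - e%:E < esum F a)%E by rewrite esum_fset.
move: Sfin SF; rewrite SE fin_numD => /andP[].
move: (esum F a) (esum (~` F) a) => [x| |] // [y| |] // _ _.
by rewrite -EFinD !lte_fin => ?; rewrite -(ltrD2l x) -ltrBlDr.
Qed.

Lemma esum_subset (P Q : set int) (a : int -> \bar R) :
  (forall k, 0 <= a k)%E -> P `<=` Q ->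
  (\esum_(k in P) a k <= \esum_(k in Q) a k)%E.
Proof.
move=> a0 PQ; rewrite esum_mkcond [leRHS]esum_mkcond; apply: le_esum => k _.
case: ifPn => [|_]; last by case: ifP.
by rewrite !inE => /PQ Qk; rewrite mem_set.
Qed.

Section def.
Variable V : normedModType R[i].
Implicit Types (u v : int -> V) (L M : V).

(* Unconditional convergence; it determines [summability.sum u] (see [sum_toE]),
   which has a junk value when the partial sums diverge. *)
Definition sum_to u L := forall e : R, 0 < e -> exists A : {fset int},
  forall B : {fset int}, (A `<=` B)%fset -> nrm (L - \sum_(k <- B) u k) < e.

Lemma nrmN (w : V) : nrm (- w) = nrm w.
Proof. by rewrite /nrm normrN. Qed.

Lemma nrm_distrC (v w : V) : nrm (v - w) = nrm (w - v).
Proof. by rewrite -nrmN opprB. Qed.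

Lemma nrm_dist3 (a b c d : V) :
  nrm (a - d) <= nrm (a - b) + nrm (b - c) + nrm (d - c).
Proof.
have -> : a - d = (a - b) + (b - c) - (d - c).
  by rewrite addrA subrK opprB addrA subrK.
by rewrite (le_trans (nrmD _ _))// nrmN lerD2r nrmD.
Qed.

Lemma nrm_sum (I : Type) (r : seq I) (P : pred I) (F : I -> V) :
  nrm (\sum_(i <- r | P i) F i) <= \sum_(i <- r | P i) nrm (F i).
Proof.
elim/big_ind2: _ => [|x a y b xa yb|//]; first by rewrite nrm0.
by rewrite (le_trans (nrmD _ _))// lerD.
Qed.

Lemma nrm_gt0 (v : V) : (0 < nrm v) = (v != 0).
Proof. by rewrite lt_neqAle eq_sym nrm_eq0 nrm_ge0 andbT. Qed.

Lemma sum_toE u L : sum_to u L -> summability.sum u = L.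
Proof.
move=> uL; have FF : ProperFilter (@summability.totally int).
  exact: summability.totally_filter.
apply: (@cvg_lim V); first exact: norm_hausdorff.
apply/(@cvgrPdist_lt _ V) => e e0.
(* Here e is a positive element of R[i], hence real, and the estimate is carried out for its real
   part. *)
have er : e = (complex.Re e)%:C by rewrite RRe_real// gtr0_real.
have [|A AB] := uL (complex.Re e); first by rewrite -ltcR -er.
exists A => //= B /AB; rewrite -ltcR -er -nrmE /summability.partial_sum.
by rewrite big_seq_fsetE.
Qed.

Lemma sum_to_unique u L M : sum_to u L -> sum_to u M -> L = M.
Proof. by move=> /sum_toE <- /sum_toE <-. Qed.

Lemma eq_sum_to u v L : u =1 v -> sum_to u L -> sum_to v L.
Proof. by move=> /funext ->. Qed.

Lemma sum_toD u v L M : sum_to u L -> sum_to v M -> sum_to (u \+ v) (L + M).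
Proof.
move=> uL vM e e0; have e20 : 0 < e / 2 by rewrite divr_gt0.
have [A AL] := uL _ e20; have [B BM] := vM _ e20.
exists (A `|` B)%fset => C; rewrite fsubUset => /andP[/AL uC /BM vC].
rewrite big_split/= opprD addrACA (le_lt_trans (nrmD _ _))//.
by rewrite (splitr e) ltrD.
Qed.

Lemma sum_to_fset (A : {fset int}) u : (forall k, k \notin A -> u k = 0) ->
  sum_to u (\sum_(k <- A) u k).
Proof.
move=> uA e e0; exists A => B AB.
suff -> : \sum_(k <- B) u k = \sum_(k <- A) u k by rewrite subrr nrm0.
rewrite (big_fset_incl _ AB)// => k _; exact: uA.
Qed.

Lemma sum_to1 (j : int) u : (forall k, k != j -> u k = 0) -> sum_to u (u j).
Proof.
move=> uj; have -> : u j = \sum_(k <- [fset j]%fset) u k.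
  by rewrite big_seq_fset1.
by apply: sum_to_fset => k; rewrite inE; exact: uj.
Qed.

Lemma sum_to0 : sum_to (fun=> 0) 0.
Proof. exact: (@sum_to1 0 (fun=> 0)). Qed.

Lemma sum_to_bij u L (e : int -> int) : set_bij setT setT e ->
  sum_to u L -> sum_to (u \o e) L.
Proof.
move=> [_ einj esurj] uL r r0; have [A AL] := uL r r0.
have /choice[f fK] : forall y, exists x, e x = y.
  by move=> y; have [x _ <-] := esurj y I; exists x.
have ei : injective e by move=> x y; apply: einj; rewrite inE.
(* If B contains a preimage under e of each point of A, then the image of B contains A. *)
exists [fset f k | k in A]%fset => B fAB.
have := AL [fset e k | k in B]%fset; rewrite big_imfset/=; last first.
  by move=> x y _ _ /ei.
apply; apply/fsubsetP => k kA; apply/imfsetP; exists (f k) => //=.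
by apply: (fsubsetP fAB); apply/imfsetP; exists k.
Qed.

Lemma sum_to_le u L : sum_to u L ->
  ((nrm L)%:E <= \esum_(k in [set: int]) (nrm (u k))%:E)%E.
Proof.
move=> uL; apply/lee_addgt0Pr => e e0.
have [A /(_ A (fsubset_refl A)) AL] := uL e e0.
rewrite (@le_trans _ _ ((\sum_(k <- A) nrm (u k))%:E + e%:E)%E)//.
  rewrite -EFinD lee_fin -[L](subrK (\sum_(k <- A) u k)) addrC.
  by rewrite (le_trans (nrmD _ _))// lerD ?nrm_sum// ltW.
rewrite leeD2r// -sumEFin esum_ge//; exists [set` A]; first by split.
by rewrite fsbig_finite//= set_fsetK.
Qed.

(** Adding the finite family -u on A cancels the terms in A, so the difference is itself the sum of
    a family supported off A, to which [sum_to_le] applies. *)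
Lemma sum_to_tail u L (A : {fset int}) : sum_to u L ->
  ((nrm (L - \sum_(k <- A) u k))%:E <=
     \esum_(k in ~` [set` A]) (nrm (u k))%:E)%E.
Proof.
move=> uL; rewrite esum_mkcond.
have : sum_to (u \+ (fun k => if k \in A then - u k else 0))
    (L - \sum_(k <- A) u k).
  apply: sum_toD => //.
  rewrite -sumrN [X in sum_to _ X]big_seq.
  rewrite (eq_bigr (fun k => if k \in A then - u k else 0)); last first.
    by move=> k ->.
  by rewrite -big_seq; apply: sum_to_fset => k /negbTE ->.
move=> /sum_to_le/le_trans; apply; apply: le_esum => k _ /=.
case: ifPn => kA; first by rewrite subrr nrm0 memNset//= => -/(_ kA).
by rewrite addr0 mem_set//=; exact/negP.
Qed.

(** Completeness proofs first build a candidate limit by pointwise means; a bound of its errors by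
    the tails of one convergent series then gives convergence in norm. *)
Lemma sum_to_criterion u L (b : int -> \bar R) :
  (forall k, 0 <= b k)%E -> (\esum_(k in [set: int]) b k < +oo)%E ->
  (forall A : {fset int},
    (nrm (L - \sum_(k <- A) u k))%:E <= \esum_(k in ~` [set` A]) b k)%E ->
  sum_to u L.
Proof.
move=> b0 boo h e e0; have [A Ae] := esum_tail b0 boo e0.
exists A => B AB; rewrite -lte_fin (le_lt_trans (h B))// (le_lt_trans _ Ae)//.
by apply: esum_subset => // k /= kB kA; apply: kB; exact: (fsubsetP AB).
Qed.

Definition abs_summable u := (\esum_(k in [set: int]) (nrm (u k))%:E < +oo)%E.

Lemma abs_summable_le (b : int -> \bar R) u :
  (forall k, (nrm (u k))%:E <= b k)%E ->
  (\esum_(k in [set: int]) b k < +oo)%E -> abs_summable u.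
Proof. by move=> ub; apply: le_lt_trans; apply: le_esum. Qed.

End def.

Lemma sum_to_map (V W : normedModType R[i]) (phi : V -> W) (C : R) u L :
  (forall c v w, phi (c *: v + w) = c *: phi v + phi w) ->
  (forall v, nrm (phi v) <= C * nrm v) ->
  sum_to u L -> sum_to (phi \o u) (phi L).
Proof.
move=> lin bnd uL e e0.
have phi0 : phi 0 = 0.
  by have := lin (-1) 0 0; rewrite scaler0 addr0 scaleN1r addNr.
have phiD v w : phi (v + w) = phi v + phi w by rewrite -[v]scale1r lin !scale1r.
have phiB v w : phi (v - w) = phi v - phi w.
  by rewrite addrC -scaleN1r lin scaleN1r addrC.
(* C may be zero or negative, so a positive larger bound serves as the divisor. *)
have C0 : 0 < `|C| + 1 by rewrite ltr_wpDl.
have [|A AL] := uL (e / (`|C| + 1)); first by rewrite divr_gt0.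
exists A => B /AL; rewrite ltr_pdivlMr//; apply: le_lt_trans.
rewrite -[X in _ - X](big_morph phi phiD phi0) -phiB (le_trans (bnd _))//.
rewrite mulrC ler_wpM2l ?nrm_ge0// (le_trans (ler_norm C))//.
by rewrite lerDl.
Qed.

Lemma sum_toZ (V : normedModType R[i]) (c : R[i]) (u : int -> V) L :
  sum_to u L -> sum_to (fun k => c *: u k) (c *: L).
Proof.
apply: (@sum_to_map V V (fun v => c *: v) (nrm (c : R[i]^o))).
  by move=> a v w; rewrite scalerDr !scalerA mulrC.
by move=> v; rewrite nrmZ.
Qed.

Lemma sum_to_bop (E : normedModType R[i]) (T : bop E) u L :
  sum_to u L -> sum_to (T \o u) (T L).
Proof.
by apply: (sum_to_map (C := opnorm T)); [exact: bop_linear|exact: opnorm_ge].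
Qed.

Lemma sum_to_bigl (V : normedModType R[i]) (r : seq int)
    (u : int -> int -> V) (w : int -> V) :
  (forall n, sum_to (u n) (w n)) ->
  sum_to (fun k => \sum_(n <- r) u n k) (\sum_(n <- r) w n).
Proof.
move=> uw; elim: r => [|n r IH].
  by rewrite big_nil; under eq_fun do rewrite big_nil; exact: sum_to0.
by rewrite big_cons; under eq_fun do rewrite big_cons; exact: sum_toD.
Qed.

(** For a finite A, L minus the sum of w over A is the sum over k of the row tails outside A. Its
    norm is at most the sum, over n outside A, of the absolute column sums, which is a tail of a
    convergent series. *)
Lemma sum_to_exchange (V : normedModType R[i]) (u : int -> int -> V) v w L :
  (\esum_(k in [set: int]) \esum_(n in [set: int]) (nrm (u k n))%:E < +oo)%E ->
  (forall k, sum_to (u k) (v k)) -> (forall n, sum_to (u ^~ n) (w n)) ->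
  sum_to v L -> sum_to w L.
Proof.
move=> uoo uv uw vL; have u0 k n : (0 <= (nrm (u k n))%:E)%E.
  by rewrite lee_fin nrm_ge0.
rewrite esum_exchange// in uoo.
apply: (@sum_to_criterion _ _ _
  (fun n => \esum_(k in [set: int]) (nrm (u k n))%:E)%E) => //.
  by move=> n; apply: esum_ge0.
move=> A.
have : sum_to (v \+ (fun k => (-1) *: \sum_(n <- A) u k n))
    (L + (-1) *: \sum_(n <- A) w n).
  by apply: sum_toD => //; apply: sum_toZ; exact: sum_to_bigl.
rewrite scaleN1r => /sum_to_le/le_trans; apply.
apply: (@le_trans _ _ (\esum_(k in [set: int]) \esum_(n in [set: int])
    (if n \in ~` [set` A] then (nrm (u k n))%:E else 0)))%E.
  apply: le_esum => k _; rewrite -esum_mkcond /= scaleN1r.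
  exact: sum_to_tail.
rewrite esum_exchange; last by move=> k n; case: ifP.
rewrite [leRHS]esum_mkcond; apply: le_esum => n _.
by case: ifP => // _; rewrite esum1.
Qed.

End sum_to.

(** * Absolutely summable families are summable *)

Section completeness.
Variable R : realType.

Definition sum_complete (V : normedModType R[i]) :=
  forall u : int -> V, abs_summable u -> exists L, sum_to u L.

Lemma sum_to_sum (V : normedModType R[i]) (u : int -> V) :
  sum_complete V -> abs_summable u -> sum_to u (summability.sum u).
Proof. by move=> cV /cV[L uL]; rewrite (sum_toE uL). Qed.

Lemma nrm_real (r : R) : nrm (r%:C : R[i]^o) = `|r|.
Proof.
case: ger0P => r0; first by rewrite nrm_ge0C.
by rewrite -[RHS]nrm_ge0C ?oppr_ge0 ?ltW// rmorphN nrmN.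
Qed.

Lemma nrm_ge_Re (z : R[i]) : `|complex.Re z| <= nrm (z : R[i]^o).
Proof. by rewrite -lecR -nrmE; exact: normc_ge_Re. Qed.

Lemma nrm_ge_Im (z : R[i]) : `|complex.Im z| <= nrm (z : R[i]^o).
Proof.
rewrite -lecR -nrmE [leRHS](normc_def z) lecR -sqrtr_sqr ler_wsqrtr//.
by rewrite lerDr sqr_ge0.
Qed.

Lemma sum_to_real (v : int -> R) : (forall k, 0 <= v k) ->
  (\esum_(k in [set: int]) (v k)%:E < +oo)%E ->
  exists L, sum_to (fun k => (v k)%:C : R[i]^o) L.
Proof.
move=> v0 voo; set S := esum _ _ in voo.
have Sfin : S \is a fin_num.
  by rewrite ge0_fin_numE// esum_ge0// => k _; rewrite lee_fin.
exists (fine S)%:C.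
apply: (@sum_to_criterion _ _ _ _ (fun k => (v k)%:E)) => //.
move=> A; rewrite -[X in _ - X](rmorph_sum (@real_complex R)) -rmorphB nrm_real.
have SE : S = ((\sum_(k <- A) v k)%:E + \esum_(k in ~` [set` A]) (v k)%:E)%E.
  rewrite /S (esumID [set` A]) ?setTI; last by move=> k _; rewrite lee_fin.
  congr (_ + _)%E; rewrite esum_fset//; last by move=> k _; rewrite lee_fin.
  by rewrite fsbig_finite//= set_fsetK sumEFin.
have : (0 <= \esum_(k in ~` [set` A]) (v k)%:E)%E.
  by apply: esum_ge0 => k _; rewrite lee_fin.
move: SE Sfin; case: (esum (~` _) _) => [t| |] // ->; last by [].
by rewrite /= !lee_fin => _ t0; rewrite addrAC subrr add0r ger0_norm.
Qed.

(** Real and imaginary parts are dominated by |u|, and a real family v with |v| <= |u| is the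
    difference of the nonnegative summable families v + |u| and |u|. *)
Lemma complex_sum_complete : sum_complete R[i]^o.
Proof.
move=> u uoo.
have H (v : int -> R) : (forall k, `|v k| <= nrm (u k)) ->
    exists L, sum_to (fun k => (v k)%:C : R[i]^o) L.
  move=> vu.
  have [||L uL] := @sum_to_real (fun k => nrm (u k)) => //.
    by move=> k; exact: nrm_ge0.
  have [||M vM] := @sum_to_real (fun k => v k + nrm (u k)).
  - by move=> k; have := vu k; rewrite ler_norml -lerBlDr sub0r => /andP[].
  - under eq_esum do rewrite EFinD.
    apply: (@le_lt_trans _ _ (\esum_(k in [set: int])
        ((nrm (u k))%:E + (nrm (u k))%:E)))%E.
      apply: le_esum => k _; rewrite -!EFinD lee_fin lerD2r.
      by rewrite (le_trans (ler_norm _)).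
    rewrite esumD => [|k _|k _]; rewrite ?lee_fin ?nrm_ge0//.
    exact: lte_add_pinfty.
  exists (M + (-1) *: L); apply: eq_sum_to (sum_toD vM (sum_toZ (-1) uL)) => k.
  by rewrite /= rmorphD/= scaleN1r addrK.
have [L uL] := H (fun k => complex.Re (u k)) (fun k => nrm_ge_Re (u k)).
have [M uM] := H (fun k => complex.Im (u k)) (fun k => nrm_ge_Im (u k)).
exists (L + 'i *: M); apply: eq_sum_to (sum_toD uL (sum_toZ 'i uM)) => k.
by rewrite /= [LHS](_ : _ = (u k : R[i])) // [RHS]complexE.
Qed.

Lemma CX_evalE (X : dynSystem) (r : seq int) (u : int -> CX R X) (y : X) :
  (\sum_(k <- r) u k) y = \sum_(k <- r) (u k y : R[i]^o).
Proof. by elim/big_rec2: _ => [|k a b _ <-]. Qed.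

(** The Weierstrass test: the errors of the pointwise sums are bounded by tails independent of the
    point, so the limit is a uniform limit of continuous functions. *)
Lemma CX_sum_complete (X : dynSystem) : sum_complete (CX R X).
Proof.
move=> u uoo; have uy (y : X) : exists L, sum_to (fun k => u k y : R[i]^o) L.
  apply: complex_sum_complete; apply: le_lt_trans uoo.
  by apply: le_esum => k _; rewrite lee_fin; exact: supnorm_ge.
have {uy} [f uf] := choice uy.
have tail (A : {fset int}) y :
  ((nrm (f y - (\sum_(k <- A) u k) y : R[i]^o))%:E <=
    \esum_(k in ~` [set` A]) (nrm (u k))%:E)%E.
  rewrite CX_evalE (le_trans (sum_to_tail A (uf y)))//.
  by apply: le_esum => k _; rewrite lee_fin; exact: supnorm_ge.
have fc : (f : X -> R[i]^o) \in @CX_pred R X.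
  rewrite inE => y; apply/(@cvgrPdist_lt _ R[i]^o) => e e0.
  have er : e = (complex.Re e)%:C by rewrite RRe_real// gtr0_real.
  rewrite er; set r := complex.Re _.
  have r0 : 0 < r by rewrite -ltcR -er.
  have r30 : 0 < r / 3 by rewrite divr_gt0.
  have [|A Ar] := esum_tail _ uoo r30.
    by move=> k; rewrite lee_fin nrm_ge0.
  set g := \sum_(k <- A) u k.
  have fg z : nrm (f z - g z : R[i]^o) < r / 3.
    by rewrite -lte_fin; exact: le_lt_trans (tail A z) Ar.
  have gc : {for y, continuous (g : X -> R[i]^o)}.
    exact: (@cts_fun X R[i]^o g).
  have r3C : 0 < (r / 3)%:C :> R[i] by rewrite ltcR.
  have := (@cvgrPdist_lt _ R[i]^o _ _ _ _ _).1 gc _ r3C.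
  move=> /(_ (@nbhs_filter X y)); apply: filterS => z.
  rewrite !nrmE !ltcR => gyz.
  apply: le_lt_trans (nrm_dist3 (f y) (g y) (g z) (f z)) _.
  by have := fg y; have := fg z; lra.
exists (CX_Sub fc).
apply: (@sum_to_criterion _ _ _ _ (fun k => (nrm (u k))%:E)) => //.
  by move=> k; rewrite lee_fin nrm_ge0.
move=> A; have [y _] := space_nonempty X.
have T0 : (0 <= \esum_(k in ~` [set` A]) (nrm (u k))%:E)%E.
  by apply: esum_ge0 => k _; rewrite lee_fin nrm_ge0.
move: (tail A) T0; case: (esum _ _) => [t| |]// h _; last by rewrite leey.
by rewrite lee_fin; apply: supnorm_le => z; rewrite -lee_fin; exact: (h z).
Qed.

Lemma bop_ext (E : normedModType R[i]) (S T : bop E) :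
  (forall v, S v = T v) -> S = T.
Proof. by move=> h; exact/val_inj/funext. Qed.

Lemma bop_addE (E : normedModType R[i]) (S T : bop E) v : (S + T) v = S v + T v.
Proof. by []. Qed.

Lemma bop_scaleE (E : normedModType R[i]) (c : R[i]) (T : bop E) v :
  (c *: T) v = c *: T v.
Proof. by []. Qed.

Lemma bopN (E : normedModType R[i]) (T : bop E) v : T (- v) = - T v.
Proof. by rewrite -scaleN1r bopZ scaleN1r. Qed.

Lemma bop_evalE (E : normedModType R[i]) (r : seq int) (u : int -> bop E) v :
  (\sum_(k <- r) u k) v = \sum_(k <- r) u k v.
Proof. by elim/big_rec2: _ => [|k a b _ <-]. Qed.

(** The sum is first formed vector by vector. The resulting tail bound is uniform on the unit ball,
    which upgrades strong convergence to convergence in operator norm. *)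
Lemma bop_sum_complete (E : normedModType R[i]) :
  sum_complete E -> sum_complete (bop E).
Proof.
move=> cE u uoo.
have uvoo (v : E) :
  (\esum_(k in [set: int]) ((nrm v)%:E * (nrm (u k))%:E) < +oo)%E.
  rewrite esumZl ?nrm_ge0//; last by move=> k; rewrite lee_fin nrm_ge0.
  by rewrite lte_mul_pinfty ?lee_fin ?nrm_ge0.
have uvle (v : E) k : ((nrm (u k v))%:E <= (nrm v)%:E * (nrm (u k))%:E)%E.
  by rewrite -EFinM lee_fin mulrC; exact: opnorm_ge.
have uv (v : E) : exists L, sum_to (u ^~ v) L.
  by apply: cE; exact: abs_summable_le (uvle v) (uvoo v).
have {uv} [f uf] := choice uv.
have S0 (P : set int) : (0 <= \esum_(k in P) (nrm (u k))%:E)%E.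
  by apply: esum_ge0 => k _; rewrite lee_fin nrm_ge0.
have fP : bop_pred f.
  apply/asboolP; split=> [c v w|].
    apply: (sum_to_unique (uf _)).
    apply: eq_sum_to (sum_toD (sum_toZ c (uf v)) (uf w)) => k.
    by rewrite /= bop_linear.
  exists (fine (\esum_(k in [set: int]) (nrm (u k))%:E)) => v.
  rewrite -lee_fin EFinM fineK ?ge0_fin_numE//.
  rewrite (le_trans (sum_to_le (uf v)))// muleC -esumZl ?nrm_ge0//.
    exact: le_esum.
  by move=> k; rewrite lee_fin nrm_ge0.
exists (Bop fP).
apply: (@sum_to_criterion _ _ _ _ (fun k => (nrm (u k))%:E)) => //.
  by move=> k; rewrite lee_fin nrm_ge0.
move=> A; move: (S0 (~` [set` A])) => T0.
have h v : nrm v <= 1 ->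
    ((nrm (f v - \sum_(k <- A) u k v))%:E <=
       \esum_(k in ~` [set` A]) (nrm (u k))%:E)%E.
  move=> v1; rewrite (le_trans (sum_to_tail A (uf v)))//.
  apply: le_esum => k _; rewrite (le_trans (uvle v k))// -EFinM lee_fin.
  by rewrite ler_piMl ?nrm_ge0.
move: h T0; case: (esum _ _) => [t| |]// h _; last by rewrite leey.
rewrite lee_fin; apply: opnorm_le => v /h; rewrite lee_fin; apply: le_trans.
by rewrite -bop_evalE.
Qed.

End completeness.

(** * Truncation and completeness in l^p(Z) *)

Section lp_space.
Variables (R : realType) (V : normedModType R[i]) (p : \bar R).
Variable p1 : (1 <= p)%E.
Notation lpV := (@lp R V p p1).

Definition single (k : int) (v : V) : int -> V :=
  fun j => if j == k then v else 0.

Lemma lpnorm_single k v : lpnorm p (single k v) = (nrm v)%:E.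
Proof.
case: p p1 => [r| |] // r1; last first.
  apply/eqP; rewrite eq_le; apply/andP; split.
    apply/lpnorm_inftyP => j; rewrite /single lee_fin.
    by case: eqP; rewrite // nrm0 nrm_ge0.
  by have := lpnorm_infty_ge (single k v) k; rewrite /single eqxx.
have r0 : (0 < r) by rewrite (lt_le_trans ltr01).
rewrite lpnorm_finE// (_ : esum _ _ = (nrm v `^ r)%:E).
  by rewrite poweR_EFin -powRrM mulfV ?gt_eqF// powRr1// nrm_ge0.
rewrite -(@esum_set1 _ _ k (fun=> (nrm v `^ r)%:E)) ?lee_fin ?powR_ge0//.
rewrite [RHS]esum_mkcond; apply: eq_esum => j _; rewrite /single.
case: eqVneq => [->|jk]; first by rewrite mem_set.
by rewrite memNset ?nrm0 ?powR0 ?gt_eqF//; apply/eqP.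
Qed.

Fact single_subproof k v : lp_pred p1 (single k v).
Proof. by rewrite /lp_pred lpnorm_single ltry. Qed.
Definition lp_single k v : lpV := Lp (single_subproof k v).

Lemma nrm_lp_single k v : nrm (lp_single k v) = nrm v.
Proof. by apply: EFin_inj; rewrite lp_nrmE lpnorm_single. Qed.

Lemma lpP (xi eta : lpV) : (forall k, xi k = eta k) -> xi = eta.
Proof. by move=> h; exact/val_inj/funext. Qed.

Lemma lp_addE (xi eta : lpV) k : (xi + eta) k = xi k + eta k.
Proof. by []. Qed.

Lemma lp_oppE (xi : lpV) k : (- xi) k = - xi k.
Proof. by []. Qed.

Lemma lp_scaleE c (xi : lpV) k : (c *: xi) k = c *: xi k.
Proof. by []. Qed.

Lemma lp_single_linear k c v w :
  lp_single k (c *: v + w) = c *: lp_single k v + lp_single k w.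
Proof.
apply: lpP => j; rewrite lp_addE lp_scaleE /= /single.
by case: eqP => // _; rewrite scaler0 addr0.
Qed.

Lemma lp_sumE (I : Type) (r : seq I) (u : I -> lpV) j :
  (\sum_(i <- r) u i) j = \sum_(i <- r) u i j.
Proof. by elim/big_rec2: _ => [|k a b _ <-]. Qed.

Lemma lp_le_coord (xi : lpV) k : nrm (xi k) <= nrm xi.
Proof.
rewrite -lee_fin lp_nrmE -(lpnorm_single k); apply: le_lpnorm => // j.
by rewrite /single; case: eqP => [->|]; rewrite ?nrm0 ?nrm_ge0.
Qed.

(** The argument is a plain sequence, so that a sequence can be truncated before it is known to be
    in l^p. *)
Definition lp_fin (F : {fset int}) (xi : int -> V) : lpV :=
  \sum_(k <- F) lp_single k (xi k).

Lemma lp_finE F xi j : lp_fin F xi j = if j \in F then xi j else 0.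
Proof.
rewrite /lp_fin lp_sumE; case: ifPn => jF.
  rewrite (big_fsetD1 j)//= /single eqxx big1_fset ?addr0// => k.
  by rewrite in_fsetD1 => /andP[kj _] _; rewrite eq_sym (negbTE kj).
rewrite big1_fset// => k kF _; rewrite /= /single; case: eqP => // jk.
by rewrite jk kF in jF.
Qed.

Lemma nrm_lp_fin F (xi : lpV) : nrm (lp_fin F xi) <= nrm xi.
Proof.
rewrite -lee_fin !lp_nrmE; apply: le_lpnorm => // j.
by rewrite lp_finE; case: ifP; rewrite ?nrm0 ?nrm_ge0.
Qed.

(** For finite p the sum of p-th powers is a supremum over finite sets; for p = oo truncations to
    one index suffice. *)
Lemma lpnorm_le_fin (xi : int -> V) (y : \bar R) :
  (forall F, (nrm (lp_fin F xi))%:E <= y)%E -> (lpnorm p xi <= y)%E.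
Proof.
move=> h; have y0 : (0 <= y)%E.
  by apply: le_trans (h fset0); rewrite lee_fin nrm_ge0.
have {}h (F : {fset int}) :
    (lpnorm p (fun j => if j \in F then xi j else 0%R) <= y)%E.
  apply: le_trans (h F); rewrite lp_nrmE le_eqVlt; apply/orP; left; apply/eqP.
  by congr lpnorm; apply/funext => j; rewrite lp_finE.
case: p p1 h => [r| |] // r1 h; last first.
  apply/lpnorm_inftyP => k; apply: le_trans (h [fset k]%fset).
  by apply: le_trans (lpnorm_infty_ge _ k); rewrite inE eqxx.
have r0 : 0 < r by rewrite (lt_le_trans ltr01).
rewrite lpnorm_finE//.
suff S : (\esum_(k in [set: int]) (nrm (xi k) `^ r)%:E <= y `^ r)%E.
  have -> : y = ((y `^ r) `^ r^-1)%E.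
    by rewrite -poweRrM mulfV ?gt_eqF// poweRe1.
  apply: gt0_ler_poweR; rewrite ?invr_ge0 ?(ltW r0)//.
    by rewrite in_itv/= leey andbT esum_ge0// => k _; rewrite lee_fin powR_ge0.
  by rewrite in_itv/= leey andbT poweR_ge0.
apply: ge_ereal_sup => _ [A [finA _] <-].
have := h (fset_set A); rewrite lpnorm_finE// => hA.
have S0 : (0 <= \esum_(k in [set: int])
    (nrm (if k \in fset_set A then xi k else 0%R) `^ r)%:E)%E.
  by apply: esum_ge0 => k _; rewrite lee_fin powR_ge0.
have {hA} : (\esum_(k in [set: int])
    (nrm (if k \in fset_set A then xi k else 0%R) `^ r)%:E <= y `^ r)%E.
  rewrite -[leLHS]poweRe1// -(mulVf (lt0r_neq0 r0)) poweRrM.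
  apply: gt0_ler_poweR => //; rewrite ?(ltW r0)//.
    by rewrite in_itv/= leey andbT poweR_ge0.
  by rewrite in_itv/= leey andbT.
apply: le_trans; rewrite -esum_fset//; last first.
  by move=> k _; rewrite lee_fin powR_ge0.
rewrite esum_mkcond; apply: le_esum => k _.
rewrite in_fset_set//; case: ifP => // _.
by rewrite lee_fin powR_ge0.
Qed.

Lemma lp_sum_complete : sum_complete V -> sum_complete lpV.
Proof.
move=> cV u uoo.
have uk k : exists L, sum_to (fun n => u n k) L.
  apply: cV; apply: abs_summable_le uoo => n.
  by rewrite lee_fin; exact: lp_le_coord.
have {uk} [xi uxi] := choice uk.
have tail (A : {fset int}) : (lpnorm p (xi - (\sum_(n <- A) u n : lpV))%R <=
    \esum_(n in ~` [set` A]) (nrm (u n))%:E)%E.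
  apply: lpnorm_le_fin => F.
  (* Minkowski for infinite sums, reduced to the norm bound [sum_to_tail] for
     the truncated family, whose sum is known from its coordinates. *)
  have uF : sum_to (fun n => lp_fin F (u n)) (lp_fin F xi).
    apply: sum_to_bigl => k.
    apply: (@sum_to_map _ _ _ (lp_single k) 1); last exact: uxi.
      exact: lp_single_linear.
    by move=> v; rewrite nrm_lp_single mul1r.
  have -> : lp_fin F (xi - (\sum_(n <- A) u n : lpV)) =
      lp_fin F xi - \sum_(n <- A) lp_fin F (u n).
    apply: lpP => j; rewrite lp_addE lp_oppE lp_sumE !lp_finE.
    have -> : \sum_(i <- A) lp_fin F (u i) j =
        \sum_(i <- A) (if j \in F then u i j else 0).
      by apply: eq_bigr => i _; rewrite lp_finE.
    case: ifP => _; last by rewrite big1 ?subr0.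
    by rewrite -lp_sumE.
  apply: le_trans (sum_to_tail A uF) _; apply: le_esum => n _; rewrite lee_fin.
  exact: nrm_lp_fin.
have S0 (P : set int) : (0 <= \esum_(k in P) (nrm (u k))%:E)%E.
  by apply: esum_ge0 => k _; rewrite lee_fin nrm_ge0.
(* The tail estimate for the empty set bounds the norm of xi itself. *)
have xiP : lp_pred p1 xi.
  have := tail fset0; rewrite big_seq_fset0 subr0 => /le_lt_trans; apply.
  rewrite (le_lt_trans _ uoo)// esum_subset// => k.
  by rewrite lee_fin nrm_ge0.
exists (Lp xiP).
apply: (@sum_to_criterion _ _ _ _ (fun k => (nrm (u k))%:E)) => //.
  by move=> k; rewrite lee_fin nrm_ge0.
by move=> A; rewrite lp_nrmE; exact: tail.
Qed.

End lp_space.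

(** * The representation *)

Section sigma_powers.
Variable X : dynSystem.

Lemma sigmaXS (k : int) (y : X) : sigmaX (k + 1) y = sigma (sigmaX k y).
Proof.
case: k => [n|[|n]]; first by rewrite -PoszD addn1.
  by rewrite NegzE addNr /sigmaX/= sigmaVK.
have -> : Negz n.+1 + 1 = Negz n.
  by rewrite !NegzE intS opprD addrAC addNr add0r.
exact/esym/sigmaVK.
Qed.

Lemma sigmaXD (m n : int) (y : X) : sigmaX (m + n) y = sigmaX m (sigmaX n y).
Proof.
elim/int_rect: m => [|m IH|m IH]; first by rewrite add0r.
  by rewrite -addn1 PoszD addrAC !sigmaXS IH.
(* For negative m, applying the injective [sigma] to both sides turns the step down into a step
   up. *)
apply: (can_inj (@sigmaK X)); rewrite -!sigmaXS addrAC.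
have -> : - (m.+1)%:Z + 1 = - m%:Z by rewrite intS opprD addrAC addNr add0r.
exact: IH.
Qed.

End sigma_powers.

Section weighted_shift.
Variables (R : realType) (X : dynSystem) (x : X) (p : \bar R).
Variable p1 : (1 <= p)%E.
Notation lpZ := (@lp R R[i]^o p p1).
Implicit Types (f g : CX R X) (xi : lpZ).

(** The image of the monomial f delta^n, as [pi_rep_delta_ell1] confirms. *)
Definition wshift (n : int) f : bop lpZ :=
  bop_comp (mul_op x p1 f) (shiftX p1 n).

Lemma wshiftE n f xi k : wshift n f xi k = f (sigmaX k x) * xi (k - n).
Proof. by rewrite /= shiftXE. Qed.

Lemma nrm_wshift n f : nrm (wshift n f) <= nrm f.
Proof.
apply: opnorm_le => xi xi1; apply: (@le_trans _ _ (nrm f * nrm xi)); last first.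
  by rewrite ler_piMr ?nrm_ge0.
rewrite -lee_fin EFinM !lp_nrmE -(lpnorm_comp xi p1 (addint_bij (- n))).
rewrite -[X in (X%:E * _)%E](nrm_ge0C (nrm_ge0 f)) -lpnormZ//.
apply: le_lpnorm => // k; rewrite wshiftE (nrmZ _ (xi (k - n))) nrmZ.
by rewrite ler_wpM2r ?nrm_ge0// nrm_ge0C ?nrm_ge0//; exact: supnorm_ge.
Qed.

Lemma wshift_linear n (c : R[i]) f g :
  wshift n (c *: f + g) = c *: wshift n f + wshift n g.
Proof.
apply: bop_ext => xi; apply: lpP => k.
have fgE y : (c *: f + g) y = c * f y + g y by [].
by rewrite bop_addE bop_scaleE lp_addE lp_scaleE !wshiftE fgE mulrDl -mulrA.
Qed.

(** The covariance relation: moving S^m past multiplication by g replaces g by alpha^m(g), which is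
    the twist in the product of l^1(Sigma). *)
Lemma wshiftM m n f g :
  bop_comp (wshift m f) (wshift n g) = wshift (m + n) (CX_mul f (alphaX m g)).
Proof.
apply: bop_ext => xi; apply: lpP => k.
rewrite [LHS](wshiftE m f (wshift n g xi)) !wshiftE CX_mulE alphaXE -sigmaXD.
by rewrite mulrA opprD addrA [- m + k]addrC.
Qed.

Lemma abs_summable_ell1 (a : ell1 R X) : abs_summable a.
Proof. by rewrite /abs_summable -lpnorm1E; exact: lp_finite. Qed.

Lemma lp_scalar_sum_complete : sum_complete lpZ.
Proof. exact/lp_sum_complete/complex_sum_complete. Qed.

Lemma pi_rep_sum (a : ell1 R X) :
  sum_to (fun n => wshift n (a n)) (pi_rep x p1 a).
Proof.
apply: sum_to_sum; first exact/bop_sum_complete/lp_scalar_sum_complete.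
apply: abs_summable_le (abs_summable_ell1 a) => n.
by rewrite lee_fin nrm_wshift.
Qed.

Lemma bop_eval_sum (E : normedModType R[i]) (u : int -> bop E) T v :
  sum_to u T -> sum_to (fun n => u n v) (T v).
Proof.
apply: (@sum_to_map _ (bop E) E (fun T => T v) (nrm v)) => // S.
by rewrite mulrC; exact: opnorm_ge.
Qed.

Lemma lp_eval_sum (V : normedModType R[i]) (u : int -> lp V p1)
    (zeta : lp V p1) k :
  sum_to u zeta -> sum_to (fun n => u n k) (zeta k).
Proof.
apply: (@sum_to_map _ (lp V p1) V (fun zeta => zeta k) 1) => // eta.
by rewrite mul1r; exact: lp_le_coord.
Qed.

(** The terms of this series do not involve p, which later allows the comparison of representations
    for different exponents. *)
Lemma pi_repE (a : ell1 R X) xi k :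
  sum_to (fun n => a n (sigmaX k x) * xi (k - n) : R[i]^o) (pi_rep x p1 a xi k).
Proof.
have := lp_eval_sum k (bop_eval_sum xi (pi_rep_sum a)).
by apply: eq_sum_to => n; rewrite wshiftE.
Qed.

Lemma pi_rep_linear c (a b : ell1 R X) :
  pi_rep x p1 (c *: a + b) = c *: pi_rep x p1 a + pi_rep x p1 b.
Proof.
apply: (sum_to_unique (pi_rep_sum _)).
apply: eq_sum_to (sum_toD (sum_toZ c (pi_rep_sum a)) (pi_rep_sum b)) => n.
by rewrite lp_addE lp_scaleE wshift_linear.
Qed.

Lemma nrm_pi_rep (a : ell1 R X) : nrm (pi_rep x p1 a) <= nrm a.
Proof.
rewrite -lee_fin (le_trans (sum_to_le (pi_rep_sum a)))// lp_nrmE lpnorm1E.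
by apply: le_esum => n _; rewrite lee_fin nrm_wshift.
Qed.

Definition delta_ell1 (n : int) f : ell1 R X := lp_single (lexx 1%E) n f.

Lemma pi_rep_delta_ell1 n f : pi_rep x p1 (delta_ell1 n f) = wshift n f.
Proof.
have wshift0 k : wshift k 0 = 0.
  by apply: bop_ext => xi; apply: lpP => j; rewrite wshiftE mul0r.
apply: (sum_to_unique (pi_rep_sum _)).
have -> : wshift n f = wshift n (delta_ell1 n f n) by rewrite /= /single eqxx.
apply: sum_to1 => k kn.
by rewrite /= /single (negbTE kn) wshift0.
Qed.

Lemma ell1_oneE : ell1_one R X = delta_ell1 0 (CX_one R X).
Proof. exact: lpP. Qed.

Lemma pi_rep1 : pi_rep x p1 (ell1_one R X) = bop_id lpZ.
Proof.
rewrite ell1_oneE pi_rep_delta_ell1; apply: bop_ext => xi; apply: lpP => k.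
by rewrite wshiftE mul1r subr0.
Qed.

Lemma nrm_bop_comp (S T : bop lpZ) : nrm (bop_comp S T) <= nrm S * nrm T.
Proof.
rewrite !bop_nrmE; apply: opnorm_le => v v1.
apply: le_trans (opnorm_ge S (T v)) _; apply: ler_wpM2l (opnorm_ge0 S) _ _ _.
by apply: le_trans (opnorm_ge T v) _; rewrite ler_piMr// opnorm_ge0.
Qed.

Lemma bop_comp_suml (S : bop lpZ) u T :
  sum_to u T -> sum_to (fun n => bop_comp S (u n)) (bop_comp S T).
Proof.
apply: (@sum_to_map _ (bop lpZ) (bop lpZ) (fun T => bop_comp S T) (nrm S)).
  by move=> c A B; apply: bop_ext => xi; rewrite /= bop_linear.
exact: nrm_bop_comp.
Qed.

Lemma bop_comp_sumr (S : bop lpZ) u T :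
  sum_to u T -> sum_to (fun n => bop_comp (u n) S) (bop_comp T S).
Proof.
apply: (@sum_to_map _ (bop lpZ) (bop lpZ) (fun T => bop_comp T S) (nrm S)).
  by move=> c A B; apply/val_inj/funext => xi.
by move=> A; rewrite mulrC; exact: nrm_bop_comp.
Qed.

(** After exchanging the sums, translation invariance turns each inner sum into |a(k)| times the
    norm of b, so the total is the product of the norms. *)
Lemma ell1_double_sum (a b : ell1 R X) :
  (\esum_(n in [set: int]) \esum_(k in [set: int])
    ((nrm (a k))%:E * (nrm (b (n - k)%R))%:E) < +oo)%E.
Proof.
rewrite esum_exchange; last first.
  by move=> i j; rewrite -EFinM lee_fin mulr_ge0 ?nrm_ge0.
rewrite (eq_esum (b := fun k => (nrm b)%:E * (nrm (a k))%:E)%E); last first.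
  move=> k _; rewrite esumZl ?nrm_ge0//; last first.
    by move=> n; rewrite lee_fin nrm_ge0.
  rewrite muleC lp_nrmE lpnorm1E; congr (_ * _)%E.
  rewrite [RHS](reindex_esum setT setT (fun n => n - k))//.
  exact: (addint_bij (- k)).
rewrite esumZl ?nrm_ge0//; last by move=> n; rewrite lee_fin nrm_ge0.
by rewrite lte_mul_pinfty ?lee_fin ?nrm_ge0// -lpnorm1E -lp_nrmE ltry.
Qed.

Lemma nrm_conv (a b : ell1 R X) n k :
  nrm (CX_mul (a k) (alphaX k (b (n - k)))) <= nrm (a k) * nrm (b (n - k)).
Proof.
by rewrite (le_trans (CX_nrmM _ _))// ler_wpM2l ?nrm_ge0// nrm_alphaX.
Qed.

Lemma ell1_mul_sum (a b : ell1 R X) n :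
  sum_to (fun k => CX_mul (a k) (alphaX k (b (n - k)))) (ell1_mul a b n).
Proof.
apply: sum_to_sum; first exact: CX_sum_complete.
apply: (@abs_summable_le _ _
  (fun k => (nrm (b : ell1 R X))%:E * (nrm (a k))%:E)%E).
  move=> k; rewrite -EFinM lee_fin (le_trans (nrm_conv a b n k))// mulrC.
  by rewrite ler_wpM2r ?nrm_ge0//; exact: lp_le_coord.
rewrite esumZl ?nrm_ge0//; last by move=> k; rewrite lee_fin nrm_ge0.
by rewrite lte_mul_pinfty ?lee_fin ?nrm_ge0// -lpnorm1E -lp_nrmE ltry.
Qed.

(** Both sides sum the same double family u: over n first it gives the composition, over k first the
    coefficients of the product. *)
Lemma pi_repM (a b : ell1 R X) :
  pi_rep x p1 (ell1_mul a b) = bop_comp (pi_rep x p1 a) (pi_rep x p1 b).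
Proof.
pose u (k n : int) := wshift n (CX_mul (a k) (alphaX k (b (n - k)))).
apply: (sum_to_unique (pi_rep_sum _)).
apply: (@sum_to_exchange _ _ u
    (fun k => bop_comp (wshift k (a k)) (pi_rep x p1 b))).
- rewrite esum_exchange; last by move=> k n; rewrite lee_fin nrm_ge0.
  apply: le_lt_trans (ell1_double_sum a b).
  apply: le_esum => n _; apply: le_esum => k _; rewrite -EFinM lee_fin.
  exact: le_trans (nrm_wshift _ _) (nrm_conv a b n k).
- move=> k.
  have := bop_comp_suml (wshift k (a k)) (pi_rep_sum b).
  (* The series of pi(b) is reindexed by the total degree n, which puts b (n - k) at position n. *)
  move=> /(sum_to_bij (addint_bij (- k))); apply: eq_sum_to => n /=.
  by rewrite wshiftM [k + _]addrC subrK.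
- move=> n; have := ell1_mul_sum a b n.
  apply: (@sum_to_map _ _ _ (wshift n) 1).
    by move=> *; exact: wshift_linear.
  by move=> f; rewrite mul1r nrm_wshift.
- exact: bop_comp_sumr (pi_rep_sum a).
Qed.

Lemma pi_rep_unital_contractive : unital_contractive_rep (pi_rep x p1).
Proof.
split; [exact: pi_rep_linear|exact: pi_repM|exact: pi_rep1|].
by move=> a; rewrite !nrmE lecR nrm_pi_rep.
Qed.

End weighted_shift.

(** * Aperiodic points, closed subspaces, Neumann series *)

Section aperiodic.
Variable X : dynSystem.

(** If two powers agree at x, their difference d is a period, and division with remainder by d shows
    that the orbit has at most |d| points. *)
Lemma Aper_inj (x : X) : Aper x -> injective (fun k : int => sigmaX k x).
Proof.
move=> + m n mn; apply: contraPP => /eqP mNn; rewrite /Aper/=; apply.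
set d := m - n; have d0 : d != 0 by rewrite subr_eq0.
have dx : sigmaX d x = x by rewrite /d addrC sigmaXD mn -sigmaXD addNr.
have qdx q : sigmaX (q * d) x = x.
  elim/int_rect: q => [|q IH|q IH]; first by rewrite mul0r.
    by rewrite intS mulrDl mul1r sigmaXD IH.
  rewrite -[in LHS]dx -sigmaXD intS mulNr mulrDl mul1r opprD addrAC.
  by rewrite addNr add0r -mulNr.
apply: (@sub_finite_set _ _
  ((fun r : nat => sigmaX (Posz r) x) @` `I_(absz d))).
  move=> _ [k _ <-]; exists (absz (k %% d)%Z).
    by rewrite /= -ltz_nat gez0_abs ?modz_ge0// ltz_mod.
  rewrite gez0_abs ?modz_ge0//.
  have {2}-> : k = (k %% d)%Z + (k %/ d)%Z * d by rewrite addrC -divz_eq.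
  by rewrite sigmaXD qdx.
exact/finite_image/finite_II.
Qed.

Lemma CX_separate (R : realType) (y : X) (F : set X) : finite_set F -> ~ F y ->
  exists f : CX R X,
    [/\ f y = 1, forall z, F z -> f z = 0 & forall z, nrm (f z : R[i]^o) <= 1].
Proof.
move=> finF Fy; have hX := @space_hausdorff X.
have clfin := (@accessible_finite_set_closed X).1 (hausdorff_accessible hX).
have /(@uniform_separatorP X R)[f [fc f01 fF fy]] : uniform_separator F [set y].
  apply: normal_uniform_separator.
  - exact: compact_normal hX (@space_compact X).
  - exact: clfin.
  - by apply: clfin; exact: finite_set1.
  - by apply/seteqP; split=> // z [/= Fz zy]; apply: Fy; rewrite -zy.
(* Urysohn's function is real-valued; the embedding into R[i] preserves distances and hence
   continuity. *)
have Cc : (fun z => (f z)%:C : R[i]^o) \in @CX_pred R X.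
  rewrite inE => z; apply/(@cvgrPdist_lt _ R[i]^o) => e e0.
  have er : e = (complex.Re e)%:C by rewrite RRe_real// gtr0_real.
  have r0 : 0 < complex.Re e by rewrite -ltcR -er.
  have := (@cvgrPdist_lt _ R _ _ _ _ _).1 (fc z) _ r0.
  move=> /(_ (@nbhs_filter X z)); apply: filterS => t.
  by rewrite -rmorphB er (nrmE (_ : R[i]^o)) nrm_real ltcR.
exists (CX_Sub Cc); split=> [|z Fz|z] /=.
- by rewrite (_ : f y = 1)//; apply: fy; exists y.
- by rewrite (_ : f z = 0)//; apply: fF; exists z.
- rewrite nrm_real; have /f01 : range f (f z) by exists z.
  by rewrite /= in_itv/= => /andP[fz0 fz1]; rewrite ger0_norm.
Qed.

End aperiodic.

Section closed_nrm.
Variables (R : realType) (V : normedModType R[i]).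
Implicit Type M : set V.

Lemma closed_nrmP M : closed M <->
  forall w, (forall e : R, 0 < e -> exists2 v, M v & nrm (w - v) < e) -> M w.
Proof.
split=> [clM w h|h w clw].
  apply: clM => B /nbhs_normP[e /= e0 eB].
  have er : e = (complex.Re e)%:C by rewrite RRe_real// gtr0_real.
  have [|v Mv wv] := h (complex.Re e); first by rewrite -ltcR -er.
  by exists v; split=> //; apply: eB; rewrite /= er nrmE ltcR.
apply: h => e e0; have [|v [Mv wv]] := clw [set v | nrm (w - v) < e].
  apply/nbhs_normP; exists e%:C => /=; first by rewrite ltcR.
  by move=> v /=; rewrite nrmE ltcR.
by exists v.
Qed.

Lemma subspaceZ M c v : Defs.subspace M -> M v -> M (c *: v).
Proof. by move=> [M0 MD] Mv; rewrite -[_ *: _]addr0; exact: MD. Qed.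

Lemma subspace_sum M (I : Type) (r : seq I) (u : I -> V) :
  Defs.subspace M -> (forall k, M (u k)) -> M (\sum_(k <- r) u k).
Proof.
move=> [M0 MD] Mu; elim/big_ind: _ => // v w Mv Mw.
by rewrite -[v]scale1r; exact: MD.
Qed.

Lemma closed_sum_to M (u : int -> V) L :
  Defs.subspace M -> closed M -> (forall k, M (u k)) -> sum_to u L -> M L.
Proof.
move=> sM /closed_nrmP clM Mu uL; apply: clM => e e0.
have [A /(_ _ (fsubset_refl A)) AL] := uL e e0.
by exists (\sum_(k <- A) u k) => //; exact: subspace_sum.
Qed.

End closed_nrm.

Section series_int.
Variable R : realType.

(** Series over the naturals are encoded as families on Z that vanish at negative indices, so that
    the theory of sums over Z covers them. *)
Lemma esum_Posz (a : nat -> \bar R) : (forall n, 0 <= a n)%E ->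
  \esum_(k in [set: int]) (if k is Posz n then a n else 0%E) =
  (\sum_(n <oo) a n)%E.
Proof.
move=> a0; rewrite nneseries_esumT//.
transitivity (\esum_(k in Posz @` setT) (if k is Posz n then a n else 0%E)).
  rewrite [RHS]esum_mkcond; apply: eq_esum => -[n|n] _.
    by rewrite mem_set//; exists n.
  by case: ifP.
by rewrite esum_image// => m n _ _ [].
Qed.

Lemma neumann (E : normedModType R[i]) (T : bop E) (eta : E) :
  sum_complete E -> nrm T <= 2^-1 -> exists zeta, zeta = eta + T zeta.
Proof.
move=> cE T1; pose u (k : int) := if k is Posz n then iter n T eta else 0.
(* This is the geometric bound 2^-n |eta|, written as c / 2^(n+1) with c = 2 |eta| to fit
   [epsilon_trick0], which bounds the sum by c. *)
have un n : nrm (iter n T eta) <= (nrm eta * 2) / (2 ^ n.+1)%:R.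
  elim: n => [|n IH]; first by rewrite expn1 mulfK.
  rewrite [leLHS]/= (le_trans (opnorm_ge T _))//.
  rewrite (le_trans (ler_pM (opnorm_ge0 T) (nrm_ge0 _) T1 IH))//.
  by rewrite mulrCA -invfM -natrM -expnS.
have [zeta uz] : exists zeta, sum_to u zeta.
  apply: cE; apply: (@abs_summable_le _ _ (fun k => if k is Posz n then
    ((nrm eta * 2) / (2 ^ n.+1)%:R)%:E else 0%E)).
    by case=> n; rewrite /= ?nrm0// lee_fin; exact: un.
  rewrite esum_Posz; last first.
    by move=> n; rewrite lee_fin divr_ge0// mulr_ge0// nrm_ge0.
  by rewrite (le_lt_trans (epsilon_trick0 xpredT _)) ?ltry// mulr_ge0// nrm_ge0.
(* Shifting the index by one in zeta = \sum_(k >= 0) T^k eta produces a term eta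
   at k = -1 and the terms of T zeta. *)
exists zeta; apply: (sum_to_unique (sum_to_bij (addint_bij 1) uz)).
rewrite -[eta](_ : (if -1 == -1 :> int then eta else 0) = eta)//.
apply: eq_sum_to (sum_toD (@sum_to1 _ _ (-1)
  (fun k => if k == -1 then eta else 0) _) (sum_to_bop T uz)).
  case=> [n|[|n]] /=; first by rewrite add0r addn1.
    by rewrite bop0 addr0.
  by rewrite bop0 addr0.
by move=> k /negbTE ->.
Qed.

End series_int.

(** * Density of finitely supported sequences for p < oo *)

Section lp_density.
Variables (R : realType) (V : normedModType R[i]) (p : \bar R).
Variable p1 : (1 <= p)%E.

(** The p-th power of the truncation error is a tail of the convergent series of p-th powers, so a
    tail below e^p gives an error below e. *)
Lemma lp_single_sum (xi : lp V p1) : (p < +oo)%E ->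
  sum_to (fun k => lp_single p1 k (xi k)) xi.
Proof.
case: p p1 xi => [r| |] // r1 xi _ e e0.
have r0 : 0 < r by rewrite (lt_le_trans ltr01).
have er0 : 0 < e `^ r by rewrite powR_gt0.
have pow0 k : (0 <= (nrm (xi k) `^ r)%:E)%E by rewrite lee_fin powR_ge0.
have [||A Ae] := @esum_tail _ (fun k => (nrm (xi k) `^ r)%:E) _ _ _ er0 => //.
  have := lp_finite xi; rewrite /lp_pred lpnorm_finE//.
  apply: contraTT; rewrite -!leNgt !leye_eq => /eqP ->.
  by rewrite poweRyr// invr_neq0// gt_eqF.
exists A => B AB; rewrite -lte_fin lp_nrmE lpnorm_finE//.
have -> : e%:E = ((e `^ r)%:E `^ r^-1)%E.
  by rewrite poweR_EFin -powRrM mulfV ?gt_eqF// powRr1// ltW.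
have S0 (P : set int) : (0 <= \esum_(k in P) (nrm (xi k) `^ r)%:E)%E.
  exact: esum_ge0.
set S := esum _ _.
have Se : (S < (e `^ r)%:E)%E.
  apply: le_lt_trans Ae; rewrite [leRHS]esum_mkcond; apply: le_esum => k _.
  rewrite lp_addE lp_oppE -/(lp_fin p1 B xi) lp_finE.
  case: ifPn => kB; first by rewrite subrr nrm0 powR0 ?gt_eqF//; case: ifP.
  rewrite subr0 mem_set//= => kA; move/negP: kB; apply.
  exact: (fsubsetP AB).
have SP : (0 <= S)%E by apply: esum_ge0 => k _; rewrite lee_fin powR_ge0.
move: S SP Se => [s| |] //; rewrite lee_fin lte_fin => s0 se.
by rewrite !poweR_EFin lte_fin gt0_ltr_powR ?nnegrE ?invr_gt0// ltW.
Qed.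

Lemma nonzero_coord (xi : lp V p1) : xi != 0 -> exists k, xi k != 0.
Proof.
move=> xi0; apply: contrapT => /forallNP h; move/eqP: xi0; apply.
by apply: lpP => k; apply/eqP; rewrite -[_ == _]negbK; apply/negP/h.
Qed.

End lp_density.

(** * Irreducibility for finite exponents, and c_0 *)

Section irreducibility.
Variables (R : realType) (X : dynSystem) (x : X) (p : \bar R).
Variable p1 : (1 <= p)%E.
Notation lpZ := (@lp R R[i]^o p p1).
Notation e_ k := (lp_single p1 k (1 : R[i]^o)).
Notation pi := (pi_rep x p1).

Lemma nrm_one : nrm (1 : R[i]^o) = 1.
Proof. by have := nrm_real (1 : R); rewrite normr1. Qed.

Lemma nrm_inv (c : R[i]) : c != 0 ->
  nrm (c^-1 : R[i]^o) = (nrm (c : R[i]^o))^-1.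
Proof.
move=> c0; have nc0 : nrm (c : R[i]^o) != 0 by rewrite nrm_eq0.
apply: (mulIf nc0); rewrite mulVf// -(nrmZ c^-1 (c : R[i]^o)).
by rewrite [_ *: _](mulVf c0) nrm_one.
Qed.

Lemma wshift_single n f k (v : R[i]^o) :
  wshift x p1 n f (lp_single p1 k v) =
  lp_single p1 (k + n) (f (sigmaX (k + n) x) * v).
Proof.
apply: lpP => j; rewrite wshiftE /= /single subr_eq.
by case: eqP => [->//|_]; rewrite mulr0.
Qed.

Lemma lp_singleZ k (v : R[i]^o) : lp_single p1 k v = v *: e_ k.
Proof.
apply: lpP => j; rewrite lp_scaleE /= /single; case: eqP => _.
  by rewrite [RHS]mulr1.
by rewrite scaler0.
Qed.

Lemma e_neq0 k : e_ k != 0.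
Proof. by rewrite -nrm_eq0 nrm_lp_single nrm_one oner_neq0. Qed.

Lemma pi_nondegenerate : Defs.nondegenerate pi.
Proof.
move=> h; have : [set pi a v | a in setT & v in setT] (e_ 0).
  by exists (ell1_one R X) => //; exists (e_ 0) => //; rewrite pi_rep1.
by rewrite h => /= /eqP; apply/negP/e_neq0.
Qed.

Lemma invariant_wshift (M : set lpZ) n f xi :
  Defs.invariant pi M -> M xi -> M (wshift x p1 n f xi).
Proof. by move=> Minv Mxi; rewrite -pi_rep_delta_ell1; exact: Minv. Qed.

Lemma nonzero_irreducible (M : set lpZ) : M 0 ->
  (forall xi, M xi -> xi != 0 -> M = setT) -> M = [set 0] \/ M = setT.
Proof.
move=> M0 h; have [[xi [Mxi xi0]]|nM] := pselect (exists xi, M xi /\ xi != 0).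
  by right; exact: h xi0.
left; apply/seteqP; split=> [xi Mxi|_ ->//].
by apply/eqP; apply: contrapT => /negP xi0; apply: nM; exists xi.
Qed.

Lemma approx_single (hx : Aper x) (xi : lpZ) k0 (e : R) :
  (p < +oo)%E -> 0 < e ->
  exists f, nrm (wshift x p1 0 f xi - lp_single p1 k0 (xi k0)) < e.
Proof.
move=> poo e0; have [A Ae] := lp_single_sum xi poo e0.
(* The error is compared coordinatewise with that of truncating xi to B: on B it vanishes by the
   choice of f, and off B it is at most |xi(k)| since |f| <= 1. *)
pose B := (k0 |` A)%fset.
have [||f [f1 f0 fle]] := @CX_separate X R (sigmaX k0 x)
    ((fun k => sigmaX k x) @` [set` (A `\ k0)%fset]).
- by apply: finite_image; exact: finite_fset.
- move=> [k /=]; rewrite in_fsetD1 => /andP[kk0 _] /(Aper_inj hx) kE.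
  by rewrite kE eqxx in kk0.
exists f; have {}Ae := Ae B (fsubsetU1 _ _); apply: le_lt_trans Ae.
rewrite -lee_fin !lp_nrmE; apply: le_lpnorm => // k.
rewrite !lp_addE !lp_oppE -/(lp_fin p1 B xi) lp_finE wshiftE subr0 /= /single.
case: eqVneq => [->|kk0]; first by rewrite f1 mul1r subrr nrm0 nrm_ge0.
rewrite !in_fset1U (negbTE kk0)/=; case: ifPn => kA.
  rewrite f0 ?mul0r ?subrr ?nrm0//; exists k => //=.
  by rewrite in_fsetD1 kk0.
rewrite !subr0 (nrmZ _ (xi k)) ler_piMl ?nrm_ge0//.
Qed.

Lemma pi_top_irreducible (hx : Aper x) : (p < +oo)%E -> top_irreducible pi.
Proof.
move=> poo; split; first exact: pi_nondegenerate.
move=> M sM clM Minv; apply: nonzero_irreducible; first by have [] := sM.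
move=> xi Mxi /nonzero_coord[k0 xik0].
have Mk0 : M (e_ k0).
  have : M (lp_single p1 k0 (xi k0)).
    apply/(closed_nrmP _).1 => // e e0.
    have [f fe] := approx_single hx xi k0 poo e0.
    exists (wshift x p1 0 f xi); first exact: invariant_wshift.
    by rewrite nrm_distrC.
  rewrite [X in M X -> _]lp_singleZ => /(subspaceZ (xi k0)^-1 sM).
  by rewrite scalerA mulVf// scale1r.
have Me k : M (e_ k).
  have := invariant_wshift (k - k0) (CX_one R X) Minv Mk0.
  by rewrite wshift_single mulr1 addrC subrK.
apply/seteqP; split=> // eta _.
apply: (closed_sum_to sM clM _ (lp_single_sum eta poo)) => k.
by rewrite lp_singleZ; exact: subspaceZ.
Qed.

Lemma commutantE (hx : Aper x) : (p < +oo)%E ->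
  commutant (range pi) = range (fun c : R[i] => c *: bop_id lpZ).
Proof.
move=> poo; apply/seteqP; split=> [T TC|_ [c _ <-] _ [a _ <-]]; last first.
  by apply: bop_ext => xi; rewrite /= bopZ.
have TW n f xi : T (wshift x p1 n f xi) = wshift x p1 n f (T xi).
  have := TC (wshift x p1 n f).
  rewrite -pi_rep_delta_ell1 => /(_ (ex_intro2 _ _ (delta_ell1 n f) I erefl)).
  by move=> /(congr1 (fun S : bop lpZ => S xi)).
pose c := T (e_ 0) 0.
have Te0 : T (e_ 0) = lp_single p1 0 c.
  apply: lpP => j; rewrite /= /single; case: eqVneq => [->//|j0].
  (* As f fixes e_0 and kills coordinate j, commuting with f forces coordinate j of T e_0 to
     vanish. *)
  have [||f [f1 f0 _]] := @CX_separate X R (sigmaX 0 x) [set sigmaX j x].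
  - exact: finite_set1.
  - by move=> /(Aper_inj hx) /eqP; rewrite eq_sym (negbTE j0).
  have := TW 0 f (e_ 0); rewrite wshift_single addr0 f1 mulr1 => ->.
  by rewrite wshiftE f0// mul0r.
(* T commutes with the shifts, which carry e_0 to e_n, so the scalar is the same for all n. *)
have Te n : T (e_ n) = lp_single p1 n c.
  have := TW n (CX_one R X) (e_ 0).
  by rewrite Te0 !wshift_single add0r !mul1r.
exists c => //; apply: bop_ext => xi.
have H := sum_to_bop T (lp_single_sum xi poo).
apply: (sum_to_unique _ H).
apply: eq_sum_to (sum_toZ c (lp_single_sum xi poo)) => k.
rewrite /= lp_singleZ bopZ Te.
by rewrite (lp_singleZ k c) !scalerA mulrC.
Qed.

End irreducibility.

Section p_infty.
Variables (R : realType) (X : dynSystem) (x : X) (p : \bar R).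
Variable p1 : (1 <= p)%E.
Notation lpZ := (@lp R R[i]^o p p1).
Notation e_ k := (lp_single p1 k (1 : R[i]^o)).
Notation pi := (pi_rep x p1).

(* The closure of the finitely supported sequences; for p = oo this is c_0. *)
Definition fin_closure : set lpZ :=
  [set xi : lpZ | sum_to (fun k => lp_single p1 k (xi k)) xi].

Lemma fin_closure_subspace : Defs.subspace fin_closure.
Proof.
split=> [|c xi eta xiM etaM].
  by apply: eq_sum_to (sum_to0 _) => k; rewrite lp_singleZ scale0r.
apply: eq_sum_to (sum_toD (sum_toZ c xiM) etaM) => k.
by rewrite /= -lp_single_linear.
Qed.

(** Truncations are contractive uniformly in the finite set, so an e/3 argument passes the
    convergence of the expansion to limits. *)
Lemma fin_closure_closed : closed fin_closure.
Proof.
apply/closed_nrmP => w h e e0; have e30 : 0 < e / 3 by rewrite divr_gt0.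
have [v vM wv] := h _ e30; have [A Av] := vM _ e30.
exists A => B AB; have {}Av := Av B AB.
have vw : nrm (lp_fin p1 B w - lp_fin p1 B v) <= nrm (w - v).
  have -> : lp_fin p1 B w - lp_fin p1 B v = lp_fin p1 B (w - v).
    apply: lpP => k; rewrite lp_addE lp_oppE !lp_finE lp_addE lp_oppE.
    by case: ifP; rewrite ?subrr.
  exact: nrm_lp_fin.
apply: le_lt_trans (nrm_dist3 w v (lp_fin p1 B v) (lp_fin p1 B w)) _.
rewrite -/(lp_fin p1 B v) in Av.
move: (nrm _) (nrm (v - _)) (nrm _) wv Av vw => a b c; lra.
Qed.

(** A weighted shift carries the coordinate expansion of xi to that of its image, up to a
    translation of the index; closedness then handles the series for pi(a). *)
Lemma fin_closure_invariant : Defs.invariant pi fin_closure.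
Proof.
move=> a xi xiM; apply: (closed_sum_to fin_closure_subspace fin_closure_closed _
  (bop_eval_sum xi (pi_rep_sum x p1 a))) => n.
have := sum_to_bij (addint_bij (- n)) (sum_to_bop (wshift x p1 n (a n)) xiM).
apply: eq_sum_to => k.
by rewrite [LHS]wshift_single subrK wshiftE.
Qed.

Lemma pi_not_top_irreducible : p = +oo%E -> ~ top_irreducible pi.
Proof.
move=> poo [_ /(_ _ fin_closure_subspace fin_closure_closed)].
move=> /(_ fin_closure_invariant)[M0|MT].
  have : fin_closure (e_ 0).
    rewrite /fin_closure/=.
    rewrite -[X in sum_to _ X](_ : lp_single p1 0 (e_ 0 0) = _); last first.
      by rewrite /= /single eqxx.
    apply: sum_to1 => k k0.
    by rewrite /= /single (negbTE k0) lp_singleZ scale0r.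
  by rewrite M0 => /= /eqP; apply/negP/e_neq0.
(* The constant sequence 1 is bounded but lies at distance at least 1 from every finitely supported
   sequence, as any index off the support shows. *)
have oneP : lp_pred p1 (fun=> 1 : R[i]^o).
  rewrite /lp_pred poo; apply: (@le_lt_trans _ _ 1%E); last exact: ltry.
  by apply/lpnorm_inftyP => k; rewrite nrm_one.
have : fin_closure (Lp oneP) by rewrite MT.
move=> /(_ 1 ltr01)[A /(_ _ (fsubset_refl A))].
rewrite -/(lp_fin p1 A (Lp oneP)) => Al.
have [k kA] : exists k : int, k \notin A.
  exists (Posz (\max_(a <- A) absz a).+1); apply/negP => kA.
  by have := @leq_bigmax_seq _ (enum_fset A) xpredT absz _ kA isT; rewrite ltnn.
have := le_lt_trans (lp_le_coord _ k) Al.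
by rewrite lp_addE lp_oppE lp_finE (negbTE kA) subr0 /= nrm_one ltxx.
Qed.

End p_infty.

(** * The exponents 1 and 1 < p < oo *)

Section p_one.
Variables (R : realType) (X : dynSystem) (x : X).
Variable p1 : (1 <= 1 :> \bar R)%E.
Notation lpZ := (@lp R R[i]^o 1%E p1).
Notation e_ k := (lp_single p1 k (1 : R[i]^o)).
Notation pi := (pi_rep x p1).

Lemma nrm_CX_one : nrm (CX_one R X) <= 1.
Proof. by apply: supnorm_le => y; rewrite nrm_one. Qed.

(** For p = 1 the vectors themselves embed in the algebra, with constant functions as coefficients;
    by [pi_cst_ell1] this makes e_0 cyclic. *)
Fact cst_ell1_subproof (zeta : lpZ) :
  lp_pred (lexx 1%E) (fun n => zeta n *: CX_one R X).
Proof.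
apply: le_lt_trans (lp_finite zeta); apply: le_lpnorm => // k.
by rewrite nrmZ ler_piMr ?nrm_ge0 ?nrm_CX_one.
Qed.
Definition cst_ell1 zeta : ell1 R X := Lp (cst_ell1_subproof zeta).

Lemma cst_ell1_linear c zeta eta :
  cst_ell1 (c *: zeta + eta) = c *: cst_ell1 zeta + cst_ell1 eta.
Proof.
apply: lpP => k; transitivity ((c * zeta k + eta k) *: CX_one R X) => //.
by rewrite scalerDl -scalerA.
Qed.

Lemma nrm_cst_ell1 zeta : nrm (cst_ell1 zeta) <= nrm zeta.
Proof.
rewrite -lee_fin !lp_nrmE; apply: le_lpnorm => // k.
by rewrite nrmZ ler_piMr ?nrm_ge0 ?nrm_CX_one.
Qed.

Lemma pi_cst_ell1 zeta : pi (cst_ell1 zeta) (e_ 0) = zeta.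
Proof.
apply: lpP => k; apply: (sum_to_unique (pi_repE x (cst_ell1 zeta) (e_ 0) k)).
have cstE n y : cst_ell1 zeta n y = zeta n by exact: mulr1.
rewrite -[zeta k](_ :
  cst_ell1 zeta k (sigmaX k x) * e_ 0 (k - k) = _ :> R[i]^o).
  apply: sum_to1 => n nk; rewrite /= /single subr_eq0 eq_sym (negbTE nk).
  by rewrite mulr0.
by rewrite cstE subrr /= /single eqxx mulr1.
Qed.

Fact cst_op_subproof (r : lpZ) :
  bop_pred (fun zeta : lpZ => pi (cst_ell1 zeta) r).
Proof.
apply/asboolP; split=> [c zeta eta|].
  by rewrite cst_ell1_linear pi_rep_linear.
exists (nrm r) => zeta; rewrite mulrC (le_trans (opnorm_ge _ _))//.
by rewrite ler_wpM2r ?nrm_ge0// (le_trans (nrm_pi_rep _ _ _))// nrm_cst_ell1.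
Qed.
Definition cst_op r : bop lpZ := Bop (cst_op_subproof r).

Lemma nrm_cst_op r : nrm (cst_op r) <= nrm r.
Proof.
apply: opnorm_le => zeta zeta1.
apply: le_trans (opnorm_ge (pi (cst_ell1 zeta)) r) _.
rewrite ler_piMl ?nrm_ge0// (le_trans (nrm_pi_rep _ _ _))//.
by rewrite (le_trans (nrm_cst_ell1 _)).
Qed.

Lemma near_e0_cyclic (g : lpZ) : nrm (e_ 0 - g) <= 2^-1 ->
  forall eta, exists zeta, eta = pi (cst_ell1 zeta) g.
Proof.
move=> g2 eta.
have [|zeta zetaE] := @neumann R lpZ (cst_op (e_ 0 - g)) eta
  (@lp_scalar_sum_complete R 1 p1).
  exact: le_trans (nrm_cst_op _) g2.
exists zeta; apply/eqP; rewrite -subr_eq0; apply/eqP.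
have -> : pi (cst_ell1 zeta) g = zeta - cst_op (e_ 0 - g) zeta.
  rewrite /= bopD bopN pi_cst_ell1.
  by rewrite opprB addrC subrK.
by rewrite {1}zetaE addrK subrr.
Qed.

Lemma pi_alg_irreducible : Aper x -> alg_irreducible pi.
Proof.
move=> hx; split; first exact: pi_nondegenerate.
move=> M sM Minv; apply: nonzero_irreducible; first by have [] := sM.
move=> xi Mxi /nonzero_coord[k0 v0]; set v := xi k0 in v0.
have nv0 : 0 < nrm (v : R[i]^o) by rewrite nrm_gt0.
(* Shifting f xi by -k0 and dividing by v will bring it near e_0; the precision |v|/2 then becomes
   the 1/2 required by [near_e0_cyclic]. *)
have [|f fe] := approx_single hx xi k0 (ltry 1) (_ : 0 < nrm (v : R[i]^o) / 2).
  by rewrite divr_gt0.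
pose g := v^-1 *: wshift x p1 (- k0) (CX_one R X) (wshift x p1 0 f xi).
have Mg : M g by apply: subspaceZ => //; do 2!apply: invariant_wshift => //.
have ge0 : nrm (e_ 0 - g) <= 2^-1.
  have -> : e_ 0 = v^-1 *: wshift x p1 (- k0) (CX_one R X) (lp_single p1 k0 v).
    rewrite wshift_single subrr mul1r [in RHS](lp_singleZ p1 _ v).
    by rewrite scalerA mulVf// scale1r.
  rewrite nrm_distrC /g -scalerBr nrmZ nrm_inv//.
  rewrite mulrC ler_pdivrMr// mulrC.
  set T := wshift _ _ _ _.
  have -> : T (wshift x p1 0 f xi) - T (lp_single p1 k0 v) =
      T (wshift x p1 0 f xi - lp_single p1 k0 v).
    by rewrite bopD bopN.
  rewrite (le_trans (opnorm_ge _ _))// (le_trans _ (ltW fe))//.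
  rewrite ler_piMl ?nrm_ge0// (le_trans (nrm_wshift _ _ _ _))//.
  exact: nrm_CX_one.
apply/seteqP; split=> // eta _.
by have [zeta ->] := near_e0_cyclic ge0 eta; exact: Minv.
Qed.

End p_one.

(** * A sequence in l^r outside l^1 for r > 1 *)

Section lr_not_l1.
Variable R : realType.

(** For i >= 1 the bound 1/(i+1)^2 <= 1/i - 1/(i+1) telescopes to 1 - 1/n, and the term i = 0 adds
    1. *)
Lemma partial_inv_sqr n :
  \sum_(0 <= i < n) (i.+1%:R ^- 2 : R) <= 2 - (n%:R)^-1 *+ (n != 0)%N.
Proof.
elim: n => [|n IH]; first by rewrite big_nil mulr0n subr0.
rewrite big_nat_recr//=; move: IH.
case: n => [|n]; first by rewrite big_nil /= => _; rewrite invr1 expr1n; lra.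
set S := \sum_(0 <= _ < _) _; rewrite !mulr1n.
have n0 : 0 < n.+1%:R :> R by [].
have : (n.+2%:R ^- 2 : R) <= n.+1%:R^-1 - n.+2%:R^-1.
  have -> : n.+2%:R = n.+1%:R + 1 :> R by rewrite -[n.+2]addn1 natrD.
  move: n0; set t : R := n.+1%:R => t0.
  have t10 : 0 < t + 1 by rewrite addr_gt0.
  have -> : t^-1 - (t + 1)^-1 = (t * (t + 1))^-1.
    by field; rewrite !lt0r_neq0.
  rewrite lef_pV2 ?posrE ?exprn_gt0 ?mulr_gt0//; nra.
by move=> H1 H2; rewrite (le_trans (lerD H2 H1))// addrA subrK.
Qed.

(* If l^r were contained in l^1, so would be l^(r^m) for all m, by taking r-th
   powers; but the harmonic sequence is in l^s for s >= 2. *)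
Lemma lr_not_l1 (r : R) : 1 < r -> exists y : int -> R,
  [/\ forall k, 0 <= y k, (\esum_(k in [set: int]) (y k `^ r)%:E < +oo)%E &
      \esum_(k in [set: int]) (y k)%:E = +oo%E].
Proof.
move=> r1; apply: contrapT => /forallNP nh.
have h (y : int -> R) : (forall k, 0 <= y k) ->
    (\esum_(k in [set: int]) (y k `^ r)%:E < +oo)%E ->
    (\esum_(k in [set: int]) (y k)%:E < +oo)%E.
  move=> y0 yr; rewrite ltey; apply/eqP => yoo; exact: (nh y).
have {}h (m : nat) (y : int -> R) : (forall k, 0 <= y k) ->
    (\esum_(k in [set: int]) (y k `^ (r ^+ m))%:E < +oo)%E ->
    (\esum_(k in [set: int]) (y k)%:E < +oo)%E.
  move=> y0; elim: m => [|m IH].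
    by rewrite (eq_esum (b := EFin \o y))// => k _; rewrite expr0 powRr1.
  move=> yr; apply: IH; apply: h => [k|]; first exact: powR_ge0.
  by under eq_esum do rewrite -powRrM -exprSr.
have [m rm] : exists m, 2 <= r ^+ m.
  (* Bernoulli's inequality, which gives r^m >= 2 once m >= 1/(r - 1). *)
  have bern n : 1 + n%:R * (r - 1) <= r ^+ n.
    elim: n => [|n IH]; first by rewrite mul0r addr0 expr0.
    rewrite exprS (le_trans _ (ler_wpM2l _ IH))//; last first.
      by rewrite ltW// (lt_trans ltr01).
    have : 0 <= n%:R :> R by [].
    rewrite -natr1; move: (n%:R : R) => t t0.
    by have := mulr_ge0 t0 (sqr_ge0 (r - 1)); nra.
  exists (Num.bound (r - 1)^-1); apply: le_trans (bern _).
  have r10 : 0 < r - 1 by rewrite subr_gt0.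
  rewrite -[leLHS]/(1 + 1) lerD2l -ler_pdivrMr// mul1r ltW//.
  by rewrite archi_boundP// invr_ge0 ltW.
pose y (k : int) : R := if k is Posz n then n.+1%:R^-1 else 0.
have y0 k : 0 <= y k by case: k => n /=.
have := h m y y0; rewrite (eq_esum (b := fun k => if k is Posz n then
  ((n.+1%:R : R)^-1 `^ (r ^+ m))%:E else 0%E)); last first.
  by case=> n _ //=; rewrite powR0// gt_eqF// (lt_le_trans _ rm).
rewrite esum_Posz; last by move=> n; rewrite lee_fin powR_ge0.
rewrite (eq_esum (b := fun k =>
  if k is Posz n then (n.+1%:R^-1 : R)%:E else 0%E)); last by case.
rewrite esum_Posz; last by move=> n; rewrite lee_fin.
have -> : (\sum_(n <oo) ((n.+1%:R : R)^-1 `^ (r ^+ m))%:E < +oo)%E.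
  apply: (@le_lt_trans _ _ 2%:E); last exact: ltry.
  apply: lime_le.
    by apply: is_cvg_nneseries => n _ _; rewrite lee_fin powR_ge0.
  apply: nearW => n; rewrite sumEFin lee_fin.
  (* The bases lie in (0, 1] and the exponent r^m is at least 2, so inverse squares dominate. *)
  apply: (@le_trans _ _ (\sum_(0 <= i < n) (i.+1%:R ^- 2 : R))).
    apply: ler_sum => i _; rewrite -exprVn -(powR_mulrn 2) ?invr_ge0//.
    by apply: ger_powR => //; rewrite invr_gt0 ltr0n invf_le1// ler1n.
  apply: le_trans (partial_inv_sqr n) _.
  by rewrite gerBl mulrn_wge0// invr_ge0.
(* A finite total would bound the increasing partial sums of the harmonic series. *)
move=> /(_ isT) yoo; apply: (@dvg_harmonic R).
apply: nondecreasing_is_cvgn.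
  by apply: nondecreasing_series => n _ _; exact: harmonic_ge0.
exists (fine (\sum_(n <oo) ((n.+1%:R : R)^-1)%:E)) => _ [n _ <-].
rewrite -lee_fin fineK ?ge0_fin_numE//; last first.
  by apply: nneseries_ge0 => k _ _; rewrite lee_fin.
rewrite /series/= -sumEFin; apply: nneseries_lim_ge => k _ _.
by rewrite lee_fin.
Qed.

End lr_not_l1.

Section not_alg_irreducible.
Variables (R : realType) (X : dynSystem) (x : X) (p : \bar R).
Variable p1 : (1 <= p)%E.
Notation lpZ := (@lp R R[i]^o p p1).
Notation pi := (pi_rep x p1).

Lemma pi_not_alg_irreducible : (1 < p)%E -> (p < +oo)%E -> ~ alg_irreducible pi.
Proof.
move=> pgt1 poo [_ /(_ [set xi : lpZ | lp_pred (lexx 1%E) xi])[]].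
- have [S0 SD] := @lp_submod_closed R R[i]^o 1%E (lexx 1%E).
  split; first exact: S0.
  by move=> c u v; exact: SD.
- move=> a xi /= xi1; pose xi' : lp R[i]^o (lexx 1%E) := Lp xi1.
  (* Both sides have the same coordinate series, so on l^1 the operator acts as in the case p = 1
     and its values stay in l^1. *)
  have -> : (pi a xi : int -> R[i]^o) = pi_rep x (lexx 1%E) a xi'.
    apply/funext => k; apply: (sum_to_unique (pi_repE x a xi k)).
    exact: (pi_repE x a xi' k).
  exact: lp_finite.
- move=> M0; have : [set xi : lpZ | lp_pred (lexx 1%E) xi]
      (lp_single p1 0 (1 : R[i]^o)).
    exact: single_subproof.
  by rewrite M0 => /= /eqP; apply/negP/e_neq0.
move=> MT; case: p p1 pgt1 poo MT => [r| |] // q1 r1 _ MT.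
have [y [y0 yr yoo]] := lr_not_l1 r1.
have etaP : lp_pred q1 (fun k => (y k)%:C : R[i]^o).
  rewrite /lp_pred lpnorm_finE ?(lt_trans ltr01)//.
  under eq_esum do rewrite nrm_ge0C//.
  by rewrite poweR_lty.
have : [set xi : @lp R R[i]^o r%:E q1 | lp_pred (lexx 1%E) xi] (Lp etaP).
  by rewrite MT.
rewrite /= /lp_pred lpnorm1E.
under eq_esum do rewrite nrm_ge0C//.
by rewrite yoo ltxx.
Qed.

End not_alg_irreducible.

Theorem theorem3p16 (R : realType) (Sigma : dynSystem) (x : Sigma)
    (p : \bar R) (p1 : (1 <= p)%E) (hx : Aper x) :
  [/\ unital_contractive_rep (pi_rep x p1),
      p = 1%E -> alg_irreducible (pi_rep x p1),
      (1 < p)%E -> (p < +oo)%E ->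
        ~ alg_irreducible (pi_rep x p1) /\ top_irreducible (pi_rep x p1),
      p = +oo%E -> ~ top_irreducible (pi_rep x p1) &
      (p < +oo)%E ->
        commutant (range (pi_rep x p1)) =
        range (fun c : R[i] => c *: bop_id (lp R[i]^o p1))].
Proof.
split.
- exact: pi_rep_unital_contractive.
- by move=> pE; subst p; exact: pi_alg_irreducible.
- move=> pgt1 poo; split; first exact: pi_not_alg_irreducible.
  exact: pi_top_irreducible.
- exact: pi_not_top_irreducible.
- exact: commutantE.
Qed.
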